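(* Let $n\in\mathbb{N}$ ($n\ge 1$), let $n-1<\alpha\le n$, let $a<b$ be real numbers and let $f\in AC^n[a,b]$. Then the local fractional derivative $({\cal D}^{\alpha}f)(a)$ of order $\alpha$ at the point $x=a$ can be represented by $$({\cal D}^{\alpha} f)(a)=\frac{1}{\Gamma(n-\alpha)}\lim_{x\to a+}\int_a^x \frac{1}{(x-z)^{\alpha-n+1}}\,\frac{d^n f(z)}{dz^n}\,dz ,$$ in the sense that one side exists if and only if the other does, and then they are equal.
   Context: $AC^n[a,b]$ is the space of functions $f:[a,b]\to\mathbb{R}$ that have continuous derivatives up to order $n-1$ on $[a,b]$ with $f^{(n-1)}$ absolutely continuous on $[a,b]$. For $n-1<\alpha\le n$ the left-sided Riemann-Liouville fractional derivative of order $\alpha$ is $${}_a^{RL}{\cal D}^{\alpha}_x f(x)=\frac{1}{\Gamma(n-\alpha)}\frac{d^n}{dx^n}\int_a^x\frac{f(z)\,dz}{(x-z)^{\alpha-n+1}} .$$ The local fractional derivative of order $\alpha$ ($n-1<\alpha\le n$) of $f$ at the point $a$ is $$({\cal D}^{\alpha}f)(a)=\lim_{x\to a+}\; {}_a^{RL}{\cal D}^{\alpha}_x\Big(f(x)-\sum_{k=0}^{n-1}\frac{f^{(k)}(a)}{k!}(x-a)^k\Big).$$ Conventions: for $\alpha=n$ the operator $g\mapsto\frac{1}{\Gamma(n-\alpha)}\int_a^x\frac{g(z)\,dz}{(x-z)^{\alpha-n+1}}$ (Riemann-Liouville fractional integral of order $n-\alpha=0$) is understood as the identity, so that ${}_a^{RL}{\cal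 D}^{n}_x=d^n/dx^n$. For $f\in AC^n[a,b]$ the derivative $f^{(n)}$ and the fractional derivatives are defined for almost every $x\in[a,b]$; they are regarded as functions defined up to null sets, and limits as $x\to a+$ are taken disregarding null sets. *)

(* Defs.v *)
From HB Require Import structures.
From mathcomp Require Import all_boot all_order all_algebra.
From mathcomp Require Import all_classical all_reals all_analysis.
Set Implicit Arguments.
Unset Strict Implicit.
Unset Printing Implicit Defensive.
Import Order.TTheory GRing.Theory Num.Theory.
Import numFieldNormedType.Exports.
Local Open Scope classical_set_scope.
Local Open Scope ring_scope.

(* A function on [a, b] is represented by any f : R -> R extending it: at x in *)
(* [a, b] every notion below only looks at values of f on [a, b].              *)

Section derivatives_on_segment.
Context {R : realType}.
Variables a b : R.

(* Increments h with x + h in [a, b]: at the endpoints this gives the one-sided *)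
(* derivatives.                                                                *)
Definition incr_filter (x : R) : set_system R :=
  within [set h | x + h \in `[a, b]] 0^'.

Definition derivable_seg (f : R -> R) (x : R) : Prop :=
  cvg ((f (x + h) - f x) / h @[h --> incr_filter x]).

Definition deriv_seg (f : R -> R) (x : R) : R :=
  lim ((f (x + h) - f x) / h @[h --> incr_filter x]).

Definition derivn_seg (n : nat) (f : R -> R) : R -> R := iter n deriv_seg f.

(* f has an n-th derivative at x, hence lower derivatives around x. *)
Fixpoint nderivable_seg (n : nat) (f : R -> R) (x : R) : Prop :=
  if n is m.+1 then
    (\forall y \near within `[a, b] (nbhs x), nderivable_seg m f y) /\
    derivable_seg (derivn_seg m f) x
  else True.

Definition abs_continuous_seg (f : R -> R) : Prop :=
  forall e : R, 0 < e -> exists2 d : R, 0 < d &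
    forall (m : nat) (u v : 'I_m -> R),
      (forall i, a <= u i /\ u i < v i /\ v i <= b) ->
      trivIset [set: 'I_m] (fun i => [set` `]u i, v i[]) ->
      \sum_(i < m) (v i - u i) < d ->
      \sum_(i < m) `|f (v i) - f (u i)| < e.

Definition AC_seg (n : nat) (f : R -> R) : Prop :=
  [/\ forall k x, (k.+1 < n)%N -> x \in `[a, b] ->
        derivable_seg (derivn_seg k f) x,
      forall k, (k < n)%N -> {within `[a, b], continuous (derivn_seg k f)}
    & abs_continuous_seg (derivn_seg n.-1 f)].

Lemma incr_filter_in x : x \in `]a, b[ -> incr_filter x = 0^'.
Proof.
rewrite in_itv/= => /andP[ax xb].
have D : \forall h \near (0 : R)^', x + h \in `[a, b].
  have m0 : 0 < Num.min (x - a) (b - x) by rewrite lt_min !subr_gt0 ax.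
  near=> h; rewrite in_itv/=.
  have : `|h| < Num.min (x - a) (b - x).
    by near: h; exact: dnbhs0_lt.
  rewrite lt_min !ltr_norml => /andP[/andP[h1 _] /andP[_ h2]].
  by rewrite -lerBlDl -opprB (ltW h1) -lerBrDl (ltW h2).
apply/seteqP; split => A; rewrite /incr_filter /within/= => H.
- by near=> h; apply: (near H h) => //; near: h.
- by near=> h => _; near: h; exact: H.
Unshelve. all: by end_near. Qed.

(* In the interior the derivatives are the ones of the library. *)
Lemma deriv_seg_in f x : x \in `]a, b[ -> deriv_seg f x = derive1 f x.
Proof.
move=> xab; rewrite /deriv_seg incr_filter_in// /derive1.
by under eq_fun do rewrite [x + _]addrC mulrC.
Qed.

End derivatives_on_segment.

Section right_limits_modulo_null_sets.
Context {R : realType}.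

Definition ess_at_right (a : R) : set_system R :=
  [set A | exists2 d : R, 0 < d &
     {ae (@lebesgue_measure R), forall x, x \in `]a, a + d[ -> A x}].

Global Instance ess_at_right_proper_filter (a : R) :
  ProperFilter (ess_at_right a).
Proof.
apply: Build_ProperFilter_ex.
  move=> A [d d0 [N [mN N0 sN]]]; apply: contrapT => A0.
  have : (@lebesgue_measure R [set` `]a, (a + d)%R[] <= @lebesgue_measure R N)%E.
    apply: le_measure; rewrite ?inE//.
    move=> x xI; apply: sN => /= /(_ xI) Ax; apply: A0; by exists x.
  rewrite N0 lebesgue_measure_itv/= lte_fin ltrDl d0 -EFinD lee_fin.
  by rewrite addrAC subrr add0r leNgt d0.
split.
- by exists 1 => //; apply: aeW.
- move=> A B [d d0 Ad] [e e0 Be]; exists (Num.min d e).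
    by rewrite lt_min d0.
  apply: (@filterS2 _ _ (ae_filter_ringOfSetsType _) _ _ _ _ Ad Be) => x Ax Bx; rewrite in_itv/= => /andP[ax].
  rewrite -ltrBlDl lt_min !ltrBlDl => /andP[xd xe].
  by split; [apply: Ax|apply: Bx]; rewrite in_itv/= ax.
- move=> A B AB [d d0 Ad]; exists d => //.
  by apply: (@filterS _ _ (ae_filter_ringOfSetsType _) _ _ _ Ad) => x Ax /Ax/AB.
Qed.

End right_limits_modulo_null_sets.

Section fractional_derivatives.
Context {R : realType}.
Local Notation mu := (@lebesgue_measure R).

Definition Gamma (s : R) : R :=
  \int[mu]_(x in `]0, +oo[) (x `^ (s - 1) * expR (- x)).

Variables (n : nat) (alpha a b : R).

Definition RL_integrand (g : R -> R) (x z : R) : R :=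
  g z / (x - z) `^ (alpha - n%:R + 1).

(* The fractional integral of order n - alpha is RL_coef * RL_conv g x; for    *)
(* alpha = n the formula degenerates and this product is g x by convention.    *)
Definition RL_coef : R :=
  if alpha == n%:R then 1 else (Gamma (n%:R - alpha))^-1.

Definition RL_conv (g : R -> R) (x : R) : R :=
  if alpha == n%:R then g x
  else \int[mu]_(z in `[a, x]) RL_integrand g x z.

Definition RL_conv_defined (g : R -> R) (x : R) : Prop :=
  alpha != n%:R -> mu.-integrable `[a, x] (EFin \o RL_integrand g x).

Definition RL_integral (g : R -> R) (x : R) : R := RL_coef * RL_conv g x.

Definition RL_derive (g : R -> R) : R -> R := derivn_seg a b n (RL_integral g).

Definition RL_derivable (g : R -> R) (x : R) : Prop :=
  (forall y, y \in `[a, b] -> RL_conv_defined g y) /\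
  nderivable_seg a b n (RL_integral g) x.

Definition taylor_remainder (f : R -> R) (x : R) : R :=
  f x - \sum_(k < n) derivn_seg a b k f a / k`!%:R * (x - a) ^+ k.

(* cvg alone would also accept the default values that the total functions      *)
(* deriv_seg and \int take where they are undefined.                           *)
Definition local_frac_derivable (f : R -> R) : Prop :=
  (\forall x \near ess_at_right a, RL_derivable (taylor_remainder f) x) /\
  cvg (RL_derive (taylor_remainder f) x @[x --> ess_at_right a]).

Definition local_frac_derive (f : R -> R) : R :=
  lim (RL_derive (taylor_remainder f) x @[x --> ess_at_right a]).

(* The limit of \int_a^x f^(n)(z) / (x - z)^(alpha - n + 1) dz as x --> a+;    *)
(* its existence includes that f^(n) and the integral are defined for almost   *)
(* every point near a.                                                         *)
Definition has_limit_conv_derivn (f : R -> R) : Prop :=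
  [/\ \forall x \near ess_at_right a, nderivable_seg a b n f x,
      \forall x \near ess_at_right a, RL_conv_defined (derivn_seg a b n f) x
    & cvg (RL_conv (derivn_seg a b n f) x @[x --> ess_at_right a])].

End fractional_derivatives.

(* Main.v *)
Require Import Defs.
From HB Require Import structures.
From mathcomp Require Import all_boot all_order all_algebra.
From mathcomp Require Import all_classical all_reals all_analysis.
From mathcomp Require Import measurable_realfun ring lra.
Set Implicit Arguments.
Unset Strict Implicit.
Unset Printing Implicit Defensive.
Import Order.TTheory GRing.Theory Num.Theory.
Import numFieldNormedType.Exports.
Local Open Scope classical_set_scope.
Local Open Scope ring_scope.

(** Put g for the Taylor remainder of f at a, N for n - 1, and J for the integral
    against the kernel (x - z)^-(alpha - n + 1), or the identity if alpha = n.
    The derivatives g, g', ..., g^(N) vanish at a, so each of them is the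
    indefinite integral from a of the next one, and g^(N) is the indefinite
    integral of f^(n), because f^(N) is absolutely continuous and the Taylor
    polynomial has degree less than n. Fractional and ordinary integration
    commute, which gives the same chain after J: J g^(k) is the indefinite
    integral of J g^(k+1), and J g^(N) is that of J f^(n). The function J f^(n)
    is integrable, so J g is N times continuously differentiable and its n-th
    derivative exists and equals J f^(n) almost everywhere. Hence the
    Riemann-Liouville derivative of g and the fractional integral of f^(n) are
    both defined almost everywhere and differ by the factor 1 / Gamma (n - alpha),
    which is not 0; their limits at a, taken modulo null sets, exist together
    and correspond.

    The commutation is [RL_conv_primitive]: Fubini's theorem ([triple_swap]) and
    the invariance of the Lebesgue measure under reflections. The passage from
    absolute continuity to integrals is [abs_continuous_primitive]: up to a Jordan
    decomposition the function is nondecreasing, its Stieltjes measure is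
    dominated by the Lebesgue measure, and the Radon-Nikodym theorem provides
    the density. Lebesgue's differentiation theorem makes the density equal to
    the derivative almost everywhere, and [measurable_deriv_seg] allows
    replacing the one by the other ([abs_continuous_deriv_seg]). *)

(** * Absolute continuity and total variation *)

Section AC_lists.
Context {R : realType}.
Variables a b : R.
Implicit Types (f g : R -> R) (p q : R * R) (L : seq (R * R)).

(** A pair stands for the interval between its two components. *)
Definition nonoverlap p q := (p.2 <= q.1) || (q.2 <= p.1).

Definition subitv p := [&& a <= p.1, p.1 < p.2 & p.2 <= b].

(** Lists of intervals can be concatenated and refined, which the families
    indexed by ordinals in [abs_continuous_seg] do not allow conveniently. *)
Definition acseq f := forall e : R, 0 < e -> exists2 d : R, 0 < d &
  forall L, all subitv L -> pairwise nonoverlap L ->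
    \sum_(p <- L) (p.2 - p.1) < d -> \sum_(p <- L) `|f p.2 - f p.1| < e.

Lemma nonoverlapC : symmetric nonoverlap.
Proof. by move=> p q; rewrite /nonoverlap orbC. Qed.

Lemma abs_continuous_seg_acseq f : abs_continuous_seg a b f -> acseq f.
Proof.
move=> acf e e0; have [d d0 dP] := acf _ e0; exists d => // L gL pL.
pose u (i : 'I_(size L)) := (nth (0, 0) L i).1.
pose v (i : 'I_(size L)) := (nth (0, 0) L i).2.
rewrite !(big_nth (0, 0)) !big_mkord => lL; apply: (dP _ u v) => //.
- move=> i; have /(allP gL)/and3P[] : nth (0, 0) L i \in L by exact: mem_nth.
  by [].
- apply/trivIsetP => i j _ _ ij.
  wlog ltij : i j ij / (i < j)%N.
    move=> H; have := ij; rewrite -val_eqE neq_ltn => /orP[|] lij.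
      exact: H.
    by rewrite setIC; apply: H => //; rewrite eq_sym.
  have /orP D := elimT (pairwiseP (0, 0)) pL i j (ltn_ord i) (ltn_ord j) ltij.
  apply/seteqP; split => x //= []; rewrite !in_itv/= => /andP[x1 x2] /andP[x3 x4].
  by case: D => D; [move: (lt_trans x3 x2)|move: (lt_trans x1 x4)];
    rewrite ltNge D.
Qed.

Lemma acseqB f g : acseq f -> acseq g -> acseq (fun x => f x - g x).
Proof.
move=> acf acg e e0.
have e20 : 0 < e / 2 by rewrite divr_gt0.
have [d d0 df] := acf _ e20; have [d' d'0 dg] := acg _ e20.
exists (Num.min d d'); first by rewrite lt_min d0.
move=> L gL pL; rewrite lt_min => /andP[Ld Ld'].
rewrite [ltRHS]splitr.
apply: le_lt_trans (ltrD (df _ gL pL Ld) (dg _ gL pL Ld')).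
rewrite -big_split/=; apply: ler_sum => p _.
by rewrite [X in `|X|](_ : _ = (f p.2 - f p.1) - (g p.2 - g p.1)) ?ler_normB//; ring.
Qed.

Lemma pairs_of_partition p f s : itv_partition p.1 p.2 s ->
  exists L, [/\ all (fun q => [&& p.1 <= q.1, q.1 < q.2 & q.2 <= p.2]) L,
    pairwise nonoverlap L, \sum_(q <- L) (q.2 - q.1) = p.2 - p.1 &
    \sum_(q <- L) `|f q.2 - f q.1| = variation p.1 p.2 f s].
Proof.
case: p => x y /= xys; rewrite (variation_zip f xys).
elim: s x xys => [x /itv_partition_nil ->|z s ih x xzs].
  by exists [::]; rewrite /= !big_nil subrr.
have zs := itv_partition_cons xzs.
have xz : x < z by case: xzs => /= /andP[].
have zy := itv_partition_le zs.
have [L [gL pL lL vL]] := ih _ zs.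
exists ((x, z) :: L); split.
- rewrite /= lexx xz zy/=; apply: sub_all gL => q /and3P[q1 -> ->].
  by rewrite (le_trans (ltW xz) q1).
- rewrite /= pL andbT; apply: sub_all gL => q /and3P[q1 _ _].
  by rewrite /nonoverlap/= q1.
- by rewrite big_cons/= lL addrC addrA subrK.
- by rewrite !big_cons /= vL.
Qed.

(** The sums bounded by absolute continuity may be replaced by sums of total
    variations: each interval of the list is traded, one at a time, for the
    cells of an arbitrary partition of it, which leaves the total length
    unchanged, and then the supremum over the partitions is taken. *)
Lemma acseq_TV f e : 0 < e -> acseq f -> exists2 d : R, 0 < d &
  forall L, all subitv L -> pairwise nonoverlap L ->
    \sum_(p <- L) (p.2 - p.1) < d ->
    (\sum_(p <- L) total_variation p.1 p.2 f <= e%:E)%E.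
Proof.
move=> e0 acf; have [d d0 dP] := acf _ e0; exists d => //.
(* L lists the intervals still measured by their total variation, K those *)
(* already cut into cells. *)
suff H L K : all subitv (L ++ K) -> pairwise nonoverlap (L ++ K) ->
    \sum_(p <- L ++ K) (p.2 - p.1) < d ->
    ((\sum_(p <- K) `|f p.2 - f p.1|)%:E +
     \sum_(p <- L) total_variation p.1 p.2 f <= e%:E)%E.
  move=> L gL pL lL; have := H L [::]; rewrite cats0 big_nil add0e; exact.
elim: L K => [K gK pK lK|p L ih K].
  by rewrite big_nil adde0 lee_fin ltW// dP.
rewrite /= => /andP[gp gLK] /andP[dLK pLK]; rewrite big_cons => lLK.
have [p1 p12 p2] := and3P gp.
have ihs s : itv_partition p.1 p.2 s -> ((variation p.1 p.2 f s)%:E +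
    ((\sum_(p <- K) `|f p.2 - f p.1|)%:E +
     \sum_(p <- L) total_variation p.1 p.2 f) <= e%:E)%E.
  move=> /(@pairs_of_partition _ f)[P [gP pP lP <-]].
  rewrite addeA -EFinD -big_cat/=; apply: ih.
  - move: gLK; rewrite !all_cat => /andP[-> ->]; rewrite andbT/=.
    apply: sub_all gP => q /and3P[q1 q12 q2].
    by rewrite /subitv q12 (le_trans p1 q1) (le_trans q2 p2).
  - have dP' : allrel nonoverlap P (L ++ K).
      apply/allrelP => q r qP rLK; have /and3P[q1 q12 q2] := allP gP _ qP.
      have /orP[pr|rp] := allP dLK _ rLK; apply/orP; [left|right].
      + exact: le_trans pr.
      + exact: le_trans q1.
    move: pLK dP'; rewrite !pairwise_cat !allrel_catr => /and3P[LK -> ->].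
    move=> /andP[PL PK]; rewrite LK pP PK !andbT.
    by apply/allrelP => q r qL rP; rewrite nonoverlapC; move/allrelP: PL; apply.
  - by rewrite !big_cat/= lP addrCA -big_cat.
rewrite big_cons addeCA; set c := (X in (_ + X)%E).
(* the supremum can be isolated only once the rest of the sum is finite *)
have cfin : c \is a fin_num.
  have c0 : (0 <= c)%E.
    rewrite adde_ge0 ?lee_fin ?sumr_ge0// big_seq sume_ge0// => q qL.
    move: gLK; rewrite all_cat => /andP[/allP/(_ _ qL)/and3P[_ /ltW q12 _] _].
    exact: total_variation_ge0.
  rewrite ge0_fin_numE//; apply: le_lt_trans (ltry e).
  apply: le_trans (ihs _ (itv_partition1 p12)).
  by rewrite leeDr// lee_fin variation_ge0.
rewrite -leeBrDr//; apply: ge_ereal_sup => _ [_ [s ps <-] <-].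
by rewrite leeBrDr//; exact: ihs.
Qed.

Hypothesis ab : a < b.

(** Composition with the projection onto the segment extends a function by its
    endpoint values, preserving continuity and monotonicity. *)
Definition clamp (x : R) := Num.max a (Num.min x b).

Lemma clamp_id x : x \in `[a, b] -> clamp x = x.
Proof.
by rewrite in_itv/= => /andP[ax xb]; rewrite /clamp min_l// max_r.
Qed.

Lemma clamp_in x : clamp x \in `[a, b].
Proof.
by rewrite in_itv/= /clamp le_max lexx/= ge_max ge_min lexx orbT andbT ltW.
Qed.

Lemma le_clamp x y : x <= y -> clamp x <= clamp y.
Proof.
move=> xy; rewrite /clamp /Num.max /Num.min.
by do 4 case: ifPn; rewrite -?leNgt; move=> *; lra.
Qed.

Lemma clampB x y : x <= y -> clamp y - clamp x <= y - x.
Proof.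
move=> xy; rewrite /clamp /Num.max /Num.min.
by do 4 case: ifPn; rewrite -?leNgt; move=> *; lra.
Qed.

Lemma acseq_clamp_lt f e : 0 < e -> acseq f -> exists2 d : R, 0 < d &
  forall x y, x <= y -> y - x < d -> `|f (clamp y) - f (clamp x)| < e.
Proof.
move=> e0 acf; have [d d0 dP] := acf _ e0; exists d => // x y xy yxd.
have := le_clamp xy; rewrite le_eqVlt => /predU1P[->|cxy].
  by rewrite subrr normr0.
have := dP [:: (clamp x, clamp y)]; rewrite !big_seq1/=; apply => //.
  rewrite /= /subitv/= cxy; move: (clamp_in x) (clamp_in y).
  by rewrite !in_itv/= => /andP[-> _] /andP[_ ->].
exact: le_lt_trans (clampB xy) yxd.
Qed.

Lemma acseq_continuous_clamp f : acseq f -> continuous (f \o clamp).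
Proof.
move=> acf x; apply/cvgrPdist_lt => e e0.
have [d d0 dP] := acseq_clamp_lt e0 acf.
near=> y; have yd : `|x - y| < d by near: y; exact: cvgr_dist_lt.
move: yd; case: (leP x y) => xy yd; [rewrite distrC|]; apply: dP => //.
- by move: yd; rewrite distrC ger0_norm ?subr_ge0.
- exact: ltW.
- by move: yd; rewrite gtr0_norm ?subr_gt0.
Unshelve. all: by end_near. Qed.

(** Pieces of length at most d / 2 have variation at most 1, and finitely many
    of them cover the segment. *)
Lemma acseq_bounded_variation f : acseq f -> bounded_variation a b f.
Proof.
move=> acf; apply/bounded_variationP; first exact: ltW.
have [d d0 dP] := acseq_TV ltr01 acf.
have d20 : 0 < d / 2 by rewrite divr_gt0.
suff H k x y : a <= x -> x <= y -> y <= b -> y - x <= k%:R * (d / 2) ->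
    total_variation x y f \is a fin_num.
  apply: (H (Num.truncn ((b - a) / (d / 2))).+1) => //; first exact: ltW.
  rewrite -ler_pdivrMr//; apply/ltW/truncnS_gt.
elim: k x y => [|k ih] x y ax xy yb.
  rewrite mul0r subr_le0 => yx; have -> : y = x by apply/eqP; rewrite eq_le xy yx.
  by rewrite total_variationxx.
case: (leP (y - x) (d / 2)) => yxd.
  move=> _; move: xy; rewrite le_eqVlt => /predU1P[<-|xy].
    by rewrite total_variationxx.
  rewrite ge0_fin_numE; last exact/total_variation_ge0/ltW.
  apply: le_lt_trans (ltry 1).
  have := dP [:: (x, y)]; rewrite !big_seq1/=; apply => //.
    by rewrite /subitv /= ax xy yb.
  by apply: le_lt_trans yxd _; rewrite ltr_pdivrMr// ltr_pMr// ltr1n.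
move=> yk; rewrite (@total_variationD _ x y (x + d / 2)); last 2 first.
- by rewrite lerDl ltW.
- by rewrite -lerBrDl ltW.
rewrite fin_numD; apply/andP; split.
- rewrite ge0_fin_numE; last by apply/total_variation_ge0; rewrite lerDl ltW.
  apply: le_lt_trans (ltry 1).
  have := dP [:: (x, x + d / 2)]; rewrite !big_seq1/=; apply => //.
    by rewrite /subitv /= ax ltrDl d20/=; lra.
  by rewrite addrC addKr ltr_pdivrMr// ltr_pMr// ltr1n.
- apply: ih => //; [lra|lra|].
  by move: yk; rewrite -natr1 mulrDl mul1r; lra.
Qed.

Definition TVfun f (x : R) := fine (total_variation a x f).

Lemma TVfunB f x y : bounded_variation a b f -> a <= x -> x <= y -> y <= b ->
  (TVfun f y - TVfun f x)%:E = total_variation x y f.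
Proof.
move=> bf ax xy yb; rewrite /TVfun.
have fx : total_variation a x f \is a fin_num.
  apply/bounded_variationP => //; apply: (bounded_variationl ax _ bf).
  exact: le_trans yb.
have fxy : total_variation x y f \is a fin_num.
  apply/bounded_variationP => //.
  apply: (bounded_variationl xy yb); apply: (bounded_variationr ax _ bf).
  exact: le_trans yb.
by rewrite (total_variationD f ax xy) fineD// addrAC subrr add0r fineK.
Qed.

Lemma acseq_TVfun f : acseq f -> acseq (TVfun f).
Proof.
move=> acf e e0; have bf := acseq_bounded_variation acf.
have e20 : 0 < e / 2 by rewrite divr_gt0.
have [d d0 dP] := acseq_TV e20 acf; exists d => // L gL pL lL.
apply: (@le_lt_trans _ _ (e / 2)); last by rewrite ltr_pdivrMr// ltr_pMr// ltr1n.
rewrite -lee_fin; apply: le_trans (dP _ gL pL lL).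
rewrite -sumEFin le_eqVlt; apply/orP; left; apply/eqP.
rewrite !big_seq; apply: eq_bigr => p pL'.
have /and3P[p1 /ltW p12 p2] := allP gL _ pL'.
rewrite -(TVfunB bf p1 p12 p2) ger0_norm//.
by rewrite -lee_fin (TVfunB bf p1 p12 p2) total_variation_ge0.
Qed.

Lemma TVfun_nondecreasing f : acseq f ->
  {in `[a, b] &, nondecreasing (TVfun f)}.
Proof.
move=> acf x y; rewrite !in_itv/= => /andP[ax xb] /andP[ay yb] xy.
rewrite -subr_ge0 -lee_fin TVfunB//; last exact: acseq_bounded_variation.
exact: total_variation_ge0.
Qed.

Lemma TVfunB_nondecreasing f : acseq f ->
  {in `[a, b] &, nondecreasing (fun x => TVfun f x - f x)}.
Proof.
move=> acf x y; rewrite !in_itv/= => /andP[ax xb] /andP[ay yb] xy.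
suff : f y - f x <= TVfun f y - TVfun f x by lra.
rewrite -lee_fin TVfunB//; last exact: acseq_bounded_variation.
apply: le_trans (total_variation_ge f xy).
by rewrite lee_fin ler_norm.
Qed.

End AC_lists.

(** * Absolutely continuous functions are indefinite integrals *)

Section open_intervals.
Context {R : realType}.
Local Notation mu := (@lebesgue_measure R).

Lemma open_interval_finite_measure (I : set R) :
  open I -> is_interval I -> (mu I < +oo)%E ->
  exists p : R * R, p.1 <= p.2 /\ I = `]p.1, p.2[%classic.
Proof.
move=> oI iI mI.
have [->|/set0P[x Ix]] := eqVneq I set0.
  by exists (0, 0); split => //=; rewrite set_itv_ge ?bnd_simp ?ltxx.
have mI' : measurable I by exact: open_measurable.
have mIfin : mu I = (fine (mu I))%:E by rewrite fineK// ge0_fin_numE.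
have H y z : I y -> I z -> y <= z -> z - y <= fine (mu I).
  move=> Iy Iz yz; rewrite -lee_fin -mIfin.
  have -> : (z - y)%:E = mu `[y, z]%classic.
    rewrite lebesgue_measure_itv/= lte_fin; case: ltP => [_|zy]; first by rewrite EFinB.
    by rewrite (@le_anti _ _ y z) ?subrr// yz.
  apply: le_measure; rewrite ?inE//= => w; rewrite /= in_itv/= => wyz.
  exact: iI Iy Iz _ wyz.
have m0 : 0 <= fine (mu I) by have := H _ _ Ix Ix (lexx _); rewrite subrr.
have lI : has_lbound I.
  exists (x - fine (mu I)) => y Iy; case: (leP x y) => [xy|yx].
    by apply: le_trans xy; rewrite lerBlDr lerDl.
  by rewrite lerBlDr -lerBlDl; apply: H => //; exact: ltW.
have uI : has_ubound I.
  exists (x + fine (mu I)) => y Iy; case: (leP y x) => [yx|xy].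
    by apply: le_trans yx _; rewrite lerDl.
  by rewrite -lerBlDl; apply: H => //; exact: ltW.
exists (inf I, sup I); split => /=.
  apply: (@le_trans _ _ x); [exact: ge_inf|exact: ub_le_sup].
have II : I° = I by exact/interior_id.
by rewrite -[LHS]II interval_bounded_interior.
Qed.

Lemma disjoint_nonoverlap (p q : R * R) : p.1 <= p.2 -> q.1 <= q.2 ->
  `]p.1, p.2[%classic `&` `]q.1, q.2[%classic = set0 ->
  [|| p.1 == p.2, q.1 == q.2 | nonoverlap p q].
Proof.
case: p q => [p1 p2] [q1 q2]/=; rewrite le_eqVlt => /orP[->//|p12].
rewrite le_eqVlt => /orP[->|q12]; first by rewrite orbT.
move=> pq0; rewrite /nonoverlap/=.
case: (leP p2 q1) => [_|q1p2]; first by rewrite !orbT.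
case: (leP q2 p1) => [_|p1q2]; first by rewrite !orbT.
exfalso; pose l := Num.max p1 q1; pose r := Num.min p2 q2.
have lr : l < r by rewrite lt_min !gt_max p12 q12 q1p2 p1q2.
have : (`]p1, p2[%classic `&` `]q1, q2[%classic) ((l + r) / 2).
  have l1 : p1 <= l by rewrite le_max lexx.
  have l2 : q1 <= l by rewrite le_max lexx orbT.
  have r1 : r <= p2 by rewrite ge_min lexx.
  have r2 : r <= q2 by rewrite ge_min lexx orbT.
  by split; rewrite /= in_itv/=; apply/andP; split; lra.
by rewrite pq0.
Qed.

End open_intervals.

Section monotone_AC.
Context {R : realType}.
Variables (a b : R).
Hypothesis ab : a < b.
Local Notation mu := (@lebesgue_measure R).
Local Notation clamp := (clamp a b).

Lemma lebesgue_stieltjes_itvoc (G : cumulative R R) x y : x <= y ->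
  lebesgue_stieltjes_measure G `]x, y]%classic = (G y - G x)%:E.
Proof.
move=> xy; rewrite /lebesgue_stieltjes_measure /measure_extension/=.
by rewrite measurable_mu_extE/= ?wlength_itv_bnd//; exact: is_ocitv.
Qed.

(** A null set has an open neighbourhood of small Lebesgue measure; the latter
    is a disjoint union of intervals, and absolute continuity bounds the total
    increment of the cumulative function over any finitely many of them. *)
Lemma nondecreasing_acseq_dominated (G : cumulative R R) (g : R -> R) :
  (G : R -> R) =1 g \o clamp -> acseq a b g ->
  forall N, measurable N -> mu N = 0%E -> lebesgue_stieltjes_measure G N = 0%E.
Proof.
move=> GE acg N mN N0; apply/eqP; rewrite eq_le measure_ge0 andbT.
apply/lee_addgt0Pr => e e0; rewrite add0e.
have [d d0 dP] := acg _ e0.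
have [|U [oU NU UN]] := @lebesgue_regularity_outer _ N d mN _ d0.
  by rewrite [ltLHS]N0 ltry.
have mU : measurable U by exact: open_measurable.
have Ud : (mu U < d%:E)%E.
  have -> : U = (U `\` N) `|` N by rewrite setUC setDUK.
  apply: (@le_lt_trans _ _ (mu (U `\` N) + mu N)%E).
    by apply: measureU2 => //; exact: measurableD.
  by rewrite [X in (_ + X)%E]N0 adde0.
pose I := open_disjoint_itv oU.
have oI k : open (I k) by exact: open_disjoint_itv_open.
have mI k : measurable (I k) by exact: open_measurable.
have UE : U = \bigcup_k I k by exact: open_disjoint_itv_bigcup.
have tI : trivIset setT I by exact: open_disjoint_itv_trivIset.
have /choice[p pP] : forall k, exists p : R * R,
    p.1 <= p.2 /\ I k = `]p.1, p.2[%classic.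
  move=> k; apply: open_interval_finite_measure => //.
    exact: open_disjoint_itv_is_interval.
  apply: (@lt_trans _ _ d%:E); last exact: ltry.
  apply: le_lt_trans Ud.
  apply: le_measure; [by rewrite inE; exact: mI|by rewrite inE; exact: mU|].
  by move=> x Ix; rewrite UE; exists k.
have muI k : mu (I k) = ((p k).2 - (p k).1)%:E.
  have [p12 ->] := pP k; rewrite lebesgue_measure_itv/= lte_fin.
  case: ltP => [_|zy]; first by rewrite EFinB.
  by rewrite (@le_anti _ _ (p k).1 (p k).2) ?subrr// p12.
apply: (@le_trans _ _ (lebesgue_stieltjes_measure G U)).
  by apply: le_measure; rewrite ?inE.
rewrite [X in lebesgue_stieltjes_measure G X]UE.
rewrite measure_semi_bigcup//; last by rewrite -UE.
apply: lime_le; first exact: is_cvg_nneseries.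
apply: nearW => K.
have GI k : (lebesgue_stieltjes_measure G (I k) <=
    (g (clamp (p k).2) - g (clamp (p k).1))%:E)%E.
  have [p12 IE] := pP k.
  have <- : lebesgue_stieltjes_measure G `](p k).1, (p k).2]%classic =
     (g (clamp (p k).2) - g (clamp (p k).1))%:E.
    by rewrite lebesgue_stieltjes_itvoc// !GE.
  apply: le_measure; [by rewrite inE; exact: mI|by rewrite inE; exact: measurable_itv|].
  rewrite IE => x /=; rewrite !in_itv/= => /andP[-> /ltW ->]//.
apply: (@le_trans _ _ (\sum_(0 <= k < K)
   (g (clamp (p k).2) - g (clamp (p k).1))%:E)%E).
  by apply: lee_sum => k _; exact: GI.
rewrite sumEFin lee_fin.
pose s := [seq k <- iota 0 K | clamp (p k).1 < clamp (p k).2].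
(* intervals collapsed by the projection contribute nothing and are dropped *)
pose L := [seq (clamp (p k).1, clamp (p k).2) | k <- s].
have sumL (h : R * R -> R) : (forall x, h (x, x) = 0) ->
    \sum_(q <- L) h q = \sum_(0 <= k < K) h (clamp (p k).1, clamp (p k).2).
  move=> h0; rewrite big_map big_filter big_mkcond/= /index_iota subn0.
  apply: eq_bigr => k _; case: ifPn => //; rewrite -leNgt => c21.
  have [p12 _] := pP k.
  by rewrite (@le_anti _ _ (clamp (p k).1) (clamp (p k).2)) ?h0// c21 le_clamp.
have gL : all (subitv a b) L.
  apply/allP => _ /mapP[k + ->]; rewrite mem_filter => /andP[c12 _].
  rewrite /subitv /= c12; move: (clamp_in ab (p k).1) (clamp_in ab (p k).2).
  by rewrite !in_itv/= => /andP[-> _] /andP[_ ->].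
have pL : pairwise nonoverlap L.
  rewrite /L pairwise_map.
  have : pairwise (fun x y : nat => x != y) s by rewrite -uniq_pairwise filter_uniq ?iota_uniq.
  apply: (@sub_in_pairwise _ [pred k | clamp (p k).1 < clamp (p k).2]); last first.
    by apply/allP => k; rewrite mem_filter => /andP[].
  move=> i j /= ci cj ij; have [pi Ii] := pP i; have [pj Ij] := pP j.
  have D : I i `&` I j = set0 by move/trivIsetP: tI => /(_ i j Logic.I Logic.I ij).
  rewrite Ii Ij in D; have := disjoint_nonoverlap pi pj D.
  case/or3P => [/eqP E|/eqP E|].
  - by move: ci; rewrite inE E ltxx.
  - by move: cj; rewrite inE E ltxx.
  - by rewrite /nonoverlap/= => /orP[] /(le_clamp a b) ->; rewrite ?orbT.
have LU : \sum_(q <- L) (q.2 - q.1) < d.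
  rewrite (sumL (fun q => q.2 - q.1)); last by move=> x; rewrite subrr.
  rewrite -lte_fin -sumEFin; apply: le_lt_trans Ud.
  rewrite UE measure_semi_bigcup//; last by rewrite -UE.
  apply: le_trans (nneseries_lim_ge K _) => //.
  apply: lee_sum => k _; rewrite [leRHS]muI lee_fin; apply: clampB.
  by have [] := pP k.
apply: le_trans (ltW (dP _ gL pL LU)).
rewrite (sumL (fun q => `|g q.2 - g q.1|)); last by move=> x; rewrite subrr normr0.
by apply: ler_sum => k _; exact: ler_norm.
Qed.

(** The density is the Radon-Nikodym derivative of the Stieltjes measure. *)
Lemma nondecreasing_acseq_primitive (g : R -> R) :
  acseq a b g -> {in `[a, b] &, nondecreasing g} ->
  exists2 w : R -> R, mu.-integrable `[a, b] (EFin \o w) &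
    forall x, x \in `[a, b] -> g x = g a + \int[mu]_(t in `[a, x]) w t.
Proof.
move=> acg ndg.
have nd : nondecreasing (g \o clamp).
  by move=> x y xy /=; apply: ndg; [exact: clamp_in|exact: clamp_in|exact: le_clamp].
have rc : right_continuous (g \o clamp).
  exact/right_continuousW/acseq_continuous_clamp.
pose G : cumulative R R := HB.pack (g \o clamp)
  (isCumulative.Build R _ R (g \o clamp) nd rc).
have GE : (G : R -> R) =1 g \o clamp by [].
pose m : {measure set (measurableTypeR R) -> \bar R} :=
  lebesgue_stieltjes_measure G.
have mab x : x \in `[a, b] -> m `]a, x]%classic = (g x - g a)%:E.
  move=> xab; have ax : a <= x by move: xab; rewrite in_itv/= => /andP[].
  rewrite -[LHS]/(lebesgue_stieltjes_measure G _) lebesgue_stieltjes_itvoc// !GE /=.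
  by rewrite !clamp_id// in_itv/= lexx ltW.
have mI : measurable (`]a, b]%classic : set (measurableTypeR R)) by [].
have mfin : (m `]a, b]%classic < +oo)%E.
  by rewrite mab ?ltry// in_itv/= lexx ltW.
pose nu : {finite_measure set (measurableTypeR R) -> \bar R} := mfrestr mI mfin.
have dom : nu `<< mu.
  apply/null_content_dominatesP => N mN N0.
  apply/eqP; rewrite eq_le measure_ge0 andbT.
  rewrite -(nondecreasing_acseq_dominated GE acg mN N0).
  apply: le_measure; rewrite ?inE//; exact: measurableI.
have [w [w0 wfin wint wE]] := @radon_nikodym_sigma_finite _ _ _ mu nu dom.
exists (fine \o w).
  apply: (@integrableS _ _ _ mu setT) => //.
  by apply: eq_integrable wint => // x _ /=; rewrite fineK.
move=> x xab; apply/eqP; rewrite addrC -subr_eq; apply/eqP.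
have /andP[ax xb] : (a <= x) && (x <= b) by move: xab; rewrite in_itv.
apply: EFin_inj; rewrite -mab//.
have -> : m `]a, x]%classic = nu `]a, x]%classic.
  rewrite /nu /= /mfrestr /mrestr; congr (m _); apply/esym/setIidl.
  by move=> t /=; rewrite !in_itv/= => /andP[-> tx]; rewrite (le_trans tx).
rewrite wE// /Rintegral integral_itv_obnd_cbnd.
  rewrite fineK.
    by apply: eq_integral => t _ /=; rewrite fineK.
  apply: integrable_fin_num => //; apply: (@integrableS _ _ _ mu setT) => //.
  by apply: eq_integrable wint => // t _ /=; rewrite fineK.
by apply: (@measurable_funS _ _ _ _ setT) => //; exact: measurable_int wint.
Qed.

End monotone_AC.

Section AC_primitive.
Context {R : realType}.
Variables (a b : R).
Hypothesis ab : a < b.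
Local Notation mu := (@lebesgue_measure R).

(** A Jordan decomposition f = V - (V - f), with V the total variation function,
    reduces the statement to nondecreasing functions. *)
Theorem abs_continuous_primitive (f : R -> R) : abs_continuous_seg a b f ->
  exists2 w : R -> R, mu.-integrable `[a, b] (EFin \o w) &
    forall x, x \in `[a, b] -> f x = f a + \int[mu]_(t in `[a, x]) w t.
Proof.
move=> /abs_continuous_seg_acseq acf.
have acV := acseq_TVfun ab acf.
have [w1 iw1 w1E] := nondecreasing_acseq_primitive ab acV (TVfun_nondecreasing ab acf).
have [w2 iw2 w2E] := nondecreasing_acseq_primitive ab (acseqB acV acf)
  (TVfunB_nondecreasing ab acf).
exists (fun x => w1 x - w2 x).
  by apply: eq_integrable (integrableB _ iw1 iw2).
move=> x xab.
have S : `[a, x]%classic `<=` `[a, b]%classic.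
  apply: subset_itvl; rewrite bnd_simp.
  by move: xab; rewrite in_itv/= => /andP[].
rewrite RintegralB//; last 2 first.
- exact: integrableS iw1.
- exact: integrableS iw2.
by have := w1E _ xab; have := w2E _ xab; lra.
Qed.

End AC_primitive.

(** * Derivatives on a segment: measurability and almost everywhere existence *)

Section difference_quotients.
Context {R : realType}.
Local Notation mu := (@lebesgue_measure R).

(** For a continuous function the Cauchy condition on difference quotients with
    fixed tolerance and fixed range of increments defines a closed set of
    points, so the set D of differentiability is Borel. On D the derivative is
    the limit of the quotients along increments 1 / (n + 1); off D the limit
    operator returns 0. *)
Lemma measurable_lim_quotient (G : R -> R) : continuous G ->
  measurable_fun setT (fun x : R => lim ((G (x + h) - G x) / h @[h --> (0:R)^'])).
Proof.
move=> cG; pose q (h x : R) := (G (x + h) - G x) / h.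
have cq h : continuous (q h).
  move=> x; apply: cvgMl; apply: cvgB; last exact: cG.
  apply: (@continuous_comp _ _ _ (fun x => x + h) G); last exact: cG.
  by apply: cvgD; [exact: cvg_id|exact: cvg_cst].
pose C (k m : nat) : set R := \bigcap_(hh in [set hh : R * R |
   (hh.1 != 0 /\ `|hh.1| < m.+1%:R^-1) /\ (hh.2 != 0 /\ `|hh.2| < m.+1%:R^-1)])
   [set x | `|q hh.1 x - q hh.2 x| <= k.+1%:R^-1].
have mC k m : measurable (C k m).
  apply: closed_measurable; apply: closed_bigI => hh _.
  have -> : [set x | `|q hh.1 x - q hh.2 x| <= k.+1%:R^-1] =
      (fun x => `|q hh.1 x - q hh.2 x|) @^-1` [set y | y <= k.+1%:R^-1] by [].
  apply: preimage_closed; last exact: closed_le.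
  by move=> x _; apply: cvg_norm; apply: cvgB; exact: cq.
pose D := \bigcap_k \bigcup_m C k m.
have mD : measurable D.
  by apply: bigcapT_measurable => k; apply: bigcup_measurable => m _; exact: mC.
have DP x : D x <-> cvg (q h x @[h --> (0:R)^']).
  split=> [Dx|/cvg_ex[l ql] k _].
    apply: cauchy_cvg; apply/cauchyP => e e0.
    have [k _ ke] : \forall k \near \oo, harmonic k < e.
      exact: (cvgr_lt _ (@cvg_harmonic R)).
    have {ke} ke := ke _ (leqnn k).
    have [m _ Cx] := Dx k I.
    pose h0 : R := m.+2%:R^-1.
    have h00 : 0 < h0 by rewrite invr_gt0.
    exists (q h0 x).
    suff : \forall h \near (0:R)^', ball (q h0 x) e (q h x) by [].
    near=> h; rewrite /ball/=.
    apply: le_lt_trans ke; have := Cx (h0, h); apply; split; split => /=.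
    - by rewrite gt_eqF.
    - by rewrite gtr0_norm// ltf_pV2 ?posrE// ltr_nat.
    - by near: h; exact: nbhs_dnbhs_neq.
    - by near: h; apply: dnbhs0_lt; rewrite invr_gt0.
  have k20 : 0 < (k.+1%:R^-1 / 2 : R) by rewrite divr_gt0// invr_gt0.
  have /cvgrPdist_lt/(_ _ k20) := ql.
  move=> [d /= d0 dP].
  have [m _ md] : \forall m \near \oo, harmonic m < d.
    exact: (cvgr_lt _ (@cvg_harmonic R)).
  have {md} md := md _ (leqnn m).
  exists m => // hh /= [[h10 h1] [h20 h2]].
  have e1 : `|l - q hh.1 x| < k.+1%:R^-1 / 2.
    by apply: dP => //=; rewrite sub0r normrN; exact: lt_trans md.
  have e2 : `|l - q hh.2 x| < k.+1%:R^-1 / 2.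
    by apply: dP => //=; rewrite sub0r normrN; exact: lt_trans md.
  rewrite (_ : _ - _ = (l - q hh.2 x) - (l - q hh.1 x)); last by ring.
  by rewrite (le_trans (ler_normB _ _))// [leRHS]splitr addrC; apply/ltW/ltrD.
pose f (n : nat) (x : R) := q n.+1%:R^-1 x * \1_D x.
apply: (@measurable_fun_cvg _ _ _ _ f).
  move=> n; apply: measurable_funM; last exact: measurable_indic.
  by apply: continuous_measurable_fun; exact: cq.
move=> x _; rewrite /f indicE.
have [xD|xD] := boolP (x \in D).
  under eq_fun do rewrite mulr1.
  move: xD; rewrite inE => /DP cx.
  have Hn : (n.+1%:R^-1 : R) @[n --> \oo] --> (0:R)^'.
    move=> A [d /= d0 dA].
    have : \forall n \near \oo, harmonic n < d by exact: (cvgr_lt _ (@cvg_harmonic R)).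
    apply: filterS => n nd; apply: dA => /=; last by rewrite gt_eqF// invr_gt0.
    by rewrite sub0r normrN gtr0_norm ?invr_gt0.
  exact: (cvg_comp _ _ Hn cx).
under eq_fun do rewrite mulr0.
have -> : lim ((G (x + h) - G x) / h @[h --> (0:R)^']) = 0.
  by apply: dvgP => /DP Dx; move: xD; rewrite notin_setE.
exact: cvg_cst.
Unshelve. all: by end_near. Qed.

End difference_quotients.

Section derivatives_on_a_segment.
Context {R : realType}.
Local Notation mu := (@lebesgue_measure R).
Variables a b : R.
Hypothesis ab : a < b.
Implicit Types f g F G : R -> R.

(** Unlike [deriv_seg], this relational form carries existence with the value. *)
Definition has_deriv_seg F (x l : R) :=
  (F (x + h) - F x) / h @[h --> incr_filter a b x] --> l.

(** Where the segment leaves no room to the right of x, step to the left. *)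
Lemma incr_filter_proper x : x \in `[a, b] -> ProperFilter (incr_filter a b x).
Proof.
rewrite in_itv/= => /andP[ax xb].
apply: Build_ProperFilter_ex => A [d /= d0 dA].
have [xb'|bx] := ltP x b.
  pose h := Num.min (d / 2) (b - x).
  have h0 : 0 < h by rewrite lt_min divr_gt0//= subr_gt0.
  exists h; apply: dA; rewrite /= ?gt_eqF//.
    rewrite sub0r normrN gtr0_norm//; apply: (@le_lt_trans _ _ (d / 2)).
      by rewrite ge_min lexx.
    by rewrite ltr_pdivrMr// ltr_pMr// ltr1n.
  have hb : h <= b - x by rewrite ge_min lexx orbT.
  by rewrite in_itv/=; apply/andP; split; lra.
pose h := Num.min (d / 2) (x - a).
have h0 : 0 < h by rewrite lt_min divr_gt0//= subr_gt0 (lt_le_trans ab).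
exists (- h); apply: dA; rewrite /= ?oppr_eq0 ?gt_eqF//.
  rewrite sub0r opprK gtr0_norm//; apply: (@le_lt_trans _ _ (d / 2)).
    by rewrite ge_min lexx.
  by rewrite ltr_pdivrMr// ltr_pMr// ltr1n.
have hb : h <= x - a by rewrite ge_min lexx orbT.
by rewrite in_itv/=; apply/andP; split; lra.
Qed.

Lemma has_deriv_segP F x l : x \in `[a, b] ->
  has_deriv_seg F x l <-> derivable_seg a b F x /\ deriv_seg a b F x = l.
Proof.
move=> xab; have PF := incr_filter_proper xab; split=> [Fl|[Fx <-]//].
split; first by apply/cvg_ex; exists l.
exact: cvg_lim.
Qed.

Lemma eq_quotient_seg F G x : x \in `[a, b] -> {in `[a, b], F =1 G} ->
  (F (x + h) - F x) / h @[h --> incr_filter a b x] =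
  (G (x + h) - G x) / h @[h --> incr_filter a b x].
Proof.
move=> xab FG; have PF := incr_filter_proper xab.
have E : \forall h \near incr_filter a b x, x + h \in `[a, b] by exact: withinT.
apply/seteqP; split => A; rewrite /fmap /= => FA;
  apply: filterS2 E FA => h /= hab; by rewrite !FG.
Qed.

Lemma eq_has_deriv_seg F G x l : x \in `[a, b] -> {in `[a, b], F =1 G} ->
  has_deriv_seg F x l -> has_deriv_seg G x l.
Proof. by move=> xab FG; rewrite /has_deriv_seg (eq_quotient_seg xab FG). Qed.

Lemma eq_deriv_seg F G x : x \in `[a, b] -> {in `[a, b], F =1 G} ->
  deriv_seg a b F x = deriv_seg a b G x.
Proof. by move=> xab FG; rewrite /deriv_seg (eq_quotient_seg xab FG). Qed.

Lemma eq_derivable_seg F G x : x \in `[a, b] -> {in `[a, b], F =1 G} ->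
  derivable_seg a b F x -> derivable_seg a b G x.
Proof. by move=> xab FG; rewrite /derivable_seg (eq_quotient_seg xab FG). Qed.

Lemma has_deriv_segD F G x l m : x \in `[a, b] ->
  has_deriv_seg F x l -> has_deriv_seg G x m ->
  has_deriv_seg (fun x => F x + G x) x (l + m).
Proof.
move=> xab Fl Gm; have PF := incr_filter_proper xab.
rewrite /has_deriv_seg.
have -> : (fun h => (F (x + h) + G (x + h) - (F x + G x)) / h) =
    (fun h => (F (x + h) - F x) / h + (G (x + h) - G x) / h).
  by apply/funext => h; rewrite -mulrDl; congr (_ / _); ring.
exact: cvgD.
Qed.

Lemma has_deriv_segZ F c x l : x \in `[a, b] ->
  has_deriv_seg F x l -> has_deriv_seg (fun x => c * F x) x (c * l).
Proof.
move=> xab Fl; have PF := incr_filter_proper xab.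
rewrite /has_deriv_seg.
have -> : (fun h => (c * F (x + h) - c * F x) / h) =
    (fun h => c * ((F (x + h) - F x) / h)).
  by apply/funext => h; rewrite -mulrBr mulrA.
by apply: cvgM => //; exact: cvg_cst.
Qed.

Lemma is_derive_has_deriv_seg F x l : x \in `[a, b] ->
  is_derive x 1 F l -> has_deriv_seg F x l.
Proof.
move=> xab [dF lF]; have PF := incr_filter_proper xab.
have /cvg_ex[m Fm] := dF.
have Em : m = l by rewrite -lF; apply/esym/cvg_lim => //.
rewrite -Em /has_deriv_seg.
have -> : (fun h => (F (x + h) - F x) / h) =
    (fun h => h^-1 *: ((F \o shift x) (h *: 1) - F x)).
  by apply/funext => h; rewrite /= [_ *: 1]mulr1 mulrC [h + x]addrC.
apply: (cvg_trans _ Fm); apply: cvg_app; exact: cvg_within.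
Qed.

Lemma continuous_clamp F : {within `[a, b], continuous F} ->
  continuous (F \o clamp a b).
Proof.
move=> cF x.
apply: (@cvg_comp _ _ _ (clamp a b) F _ (within `[a, b] (nbhs (clamp a b x)))).
  move=> A [d /= d0 dA]; exists d => //= y xy; apply: dA; last exact: clamp_in.
  apply: le_lt_trans xy; case: (leP x y) => xy.
    rewrite distrC [leRHS]distrC !ger0_norm ?subr_ge0 ?le_clamp//; exact: clampB.
  by rewrite !ger0_norm ?subr_ge0 ?le_clamp ?(ltW xy)//; exact/clampB/ltW.
by move/subspace_continuousP : cF; apply; exact: clamp_in.
Qed.

(** In the interior the derivative is that of the extension by endpoint values,
    which is continuous on the whole line. *)
Lemma measurable_deriv_seg F : {within `[a, b], continuous F} ->
  measurable_fun `[a, b] (deriv_seg a b F).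
Proof.
move=> cF.
have cG : continuous (F \o clamp a b) by exact: continuous_clamp.
have E : {in `[a, b], F =1 F \o clamp a b}.
  by move=> x xab /=; rewrite clamp_id.
apply/measurable_fun_itv_bndo_bndcP.
apply/measurable_fun_itv_obnd_cbndP.
apply: (@eq_measurable_fun _ _ _ _ _ (fun x : R => lim ((((F \o clamp a b) (x + h)
     - (F \o clamp a b) x) / h @[h --> (0:R)^'])))).
  move=> x; rewrite inE/= => xab.
  have xab' : x \in `[a, b] by apply: subset_itv_oo_cc.
  rewrite (eq_deriv_seg xab' E) /deriv_seg incr_filter_in//.
by apply: measurable_funTS; exact: measurable_lim_quotient.
Qed.

(** Lebesgue's differentiation theorem. *)
Lemma primitive_has_deriv_seg_ae w F : mu.-integrable `[a, b] (EFin \o w) ->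
  {in `[a, b], forall x, F x = F a + \int[mu]_(t in `[a, x]) w t} ->
  {ae mu, forall x, x \in `]a, b[ -> has_deriv_seg F x (w x)}.
Proof.
move=> iw FE; pose w0 := w \_ `[a, b].
have iw0 : mu.-integrable setT (EFin \o w0).
  by move: iw; rewrite integrable_mkcond// -restrict_EFin.
have loc : locally_integrable setT w0 by exact: integrable_locally.
have i0 y : mu.-integrable [set` Interval (BLeft a) (BRight y)] (EFin \o w0).
  exact: integrableS iw0.
have := FTC1 i0 loc; apply: filterS; first exact: (ae_filter_ringOfSetsType mu).
move=> x H xab; have [ax xb] : a < x /\ x < b by move: xab; rewrite in_itv/= => /andP[].
have xab' : x \in `[a, b] by apply: subset_itv_oo_cc.
have [] := H ax; set W := (fun x => \int[mu]_(t in _) _) => dW lW.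
have w0x : w0 x = w x by rewrite /w0 patchE mem_set.
have : has_deriv_seg W x (w x).
  apply: is_derive_has_deriv_seg => //; apply: DeriveDef => //.
  by rewrite -w0x -lW derive1E.
move=> HW.
have : has_deriv_seg (fun x => F a + W x) x (0 + w x).
  apply: has_deriv_segD => //; apply: is_derive_has_deriv_seg => //.
rewrite add0r; apply: eq_has_deriv_seg => // y yab /=.
rewrite [RHS]FE//; congr (_ + _); apply: eq_Rintegral => t; rewrite inE/= => tay.
rewrite /w0 patchE mem_set//=; move: tay yab; rewrite !in_itv/=.
by move=> /andP[-> ty] /andP[_ yb]; rewrite (le_trans ty).
Qed.

End derivatives_on_a_segment.

(** * Reflection invariance, the power kernel and the Gamma function *)

Section reflection.
Context {R : realType}.
Local Notation mu := (@lebesgue_measure R).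

(** A reflection maps intervals to intervals of the same length, so it preserves
    the Lebesgue measure. *)
Lemma ge0_integral_reflection (f : R -> \bar R) (c : R) :
  measurable_fun setT f -> (forall x, 0 <= f x)%E ->
  (\int[mu]_x f (c - x)%R = \int[mu]_x f x)%E.
Proof.
move=> mf f0; pose phi : measurableTypeR R -> measurableTypeR R := fun x : R => c - x.
have mphi : measurable_fun setT phi.
  by apply: measurable_funB; [exact: measurable_cst|exact: measurable_id].
have := @ge0_integral_pushforward _ _ (measurableTypeR R) (measurableTypeR R) R
  phi mphi mu setT f measurableT mf (fun x _ => f0 x).
rewrite preimage_setT => <-; apply: eq_measure_integral => A mA _.
apply/esym; apply: lebesgue_measure_unique => //.
move=> _ [[x y] _ <-]/=.
rewrite [RHS]/pushforward.
have -> : phi @^-1` `]x, y]%classic = `[c - y, c - x[%classic.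
  by apply/seteqP; split => z; rewrite /phi /= !in_itv/= => /andP[? ?];
    apply/andP; split; lra.
rewrite !lebesgue_measure_itv/= !lte_fin ltrD2l ltrN2.
by case: ifP => // _; rewrite -!EFinB; congr (_%:E); ring.
Qed.

Lemma Rintegral_reflection (f : R -> R) (c : R) :
  measurable_fun setT f -> (forall x, 0 <= f x) ->
  \int[mu]_x f (c - x) = \int[mu]_x f x.
Proof.
move=> mf f0; rewrite /Rintegral; congr fine.
apply: (ge0_integral_reflection (f := EFin \o f)) => //.
exact/measurable_EFinP.
Qed.

End reflection.

Section power_kernel.
Context {R : realType}.
Local Notation mu := (@lebesgue_measure R).
Implicit Types c L s : R.

Lemma continuous_powR_gt0 c s : 0 < s -> {for s, continuous (fun x : R => x `^ c)}.
Proof.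
move=> s0; apply: differentiable_continuous; apply/derivable1_diffP.
by apply: derivable_powR; rewrite in_itv/= s0.
Qed.

Lemma integral_powRN c L x : c < 1 -> 0 < x -> x < L ->
  (\int[mu]_(s in `[x, L]) (s `^ (- c))%:E =
   ((L `^ (1 - c) - x `^ (1 - c)) / (1 - c))%:E)%E.
Proof.
move=> c1 x0 xL; have c10 : 1 - c != 0 by rewrite subr_eq0 gt_eqF.
pose F (s : R) := (1 - c)^-1 * s `^ (1 - c).
have dF (s : R) : 0 < s -> is_derive s 1 F (s `^ (- c)).
  move=> s0; have := is_derive1_powR (1 - c) s0 => D.
  have -> : s `^ (- c) = (1 - c)^-1 *: ((1 - c) * s `^ (1 - c - 1)).
    by rewrite /GRing.scale/= mulKf//; congr (_ `^ _); ring.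
  exact: is_deriveZ.
have cF (s : R) : 0 < s -> {for s, continuous F}.
  by move=> s0; apply: cvgM; [exact: cvg_cst|exact: continuous_powR_gt0].
rewrite (@continuous_FTC2 _ _ F)//.
- by rewrite -EFinB /F -mulrBr mulrC.
- apply: continuous_in_subspaceT => s; rewrite inE/= in_itv/= => /andP[xs _].
  by apply: continuous_powR_gt0; exact: lt_le_trans xs.
- split.
  + by move=> s; rewrite in_itv/= => /andP[xs _]; have [] := dF _ (lt_trans x0 xs).
  + by apply: cvg_at_right_filter; exact: cF.
  + by apply: cvg_at_left_filter; apply: cF; exact: lt_trans xL.
- move=> s; rewrite in_itv/= => /andP[xs _].
  by rewrite derive1E; have [_ ->] := dF _ (lt_trans x0 xs).
Qed.

(** Monotone convergence along the intervals from 1 / (i + 1) to L, on which the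
    integral of the power is given by its primitive. *)
Lemma integrable_powRN c L : c < 1 ->
  mu.-integrable `]0, L] (fun s => (s `^ (- c))%:E).
Proof.
move=> c1; have [L0|L0] := leP L 0.
  by rewrite set_itv_ge ?bnd_simp -?leNgt//; exact: integrable_set0.
have mp : measurable_fun setT (fun s : R => (s `^ (- c))%:E).
  by apply/measurable_EFinP; exact: measurable_powR.
apply/integrableP; split; first exact: measurable_funTS.
apply: (@le_lt_trans _ _ (L `^ (1 - c) / (1 - c))%:E); last exact: ltry.
under eq_integral do rewrite gee0_abs ?lee_fin ?powR_ge0//.
pose F (i : nat) : set R := `[i.+1%:R^-1, L]%classic.
have UF : \bigcup_i F i = `]0, L]%classic.
  apply/seteqP; split => [s [i _]|s]; rewrite /F/= !in_itv/= => /andP[s0 sL].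
    by rewrite sL andbT (lt_le_trans _ s0)// invr_gt0.
  have [i _ /(_ i (leqnn i)) si] : \forall i \near \oo, harmonic i < s.
    exact: (cvgr_lt _ (@cvg_harmonic R)).
  by exists i => //=; rewrite in_itv/= sL andbT ltW.
rewrite -UF.
have ndF : nondecreasing_seq F.
  apply/nondecreasing_seqP => i; apply/subsetPset => s; rewrite /F/= !in_itv/=.
  move=> /andP[si ->]; rewrite andbT (le_trans _ si)//.
  by rewrite lef_pV2 ?posrE// ler_nat.
have FE := @ge0_nondecreasing_set_cvg_integral _ (measurableTypeR R) R F
  (fun s => (s `^ (- c))%:E) mu ndF (fun i => measurable_itv _)
  (fun i => measurable_funTS mp) (fun i s _ => powR_ge0 s (- c)).
rewrite -(cvg_lim _ FE)//; apply: lime_le; first by apply/cvg_ex; eexists; exact: FE.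
apply: nearW => i; have [xL|Lx|xL] := ltgtP (i.+1%:R^-1 : R) L.
- rewrite integral_powRN ?invr_gt0// lee_fin ler_pM2r ?invr_gt0 ?subr_gt0//.
  by rewrite lerBlDr lerDl powR_ge0.
- rewrite /F set_itv_ge ?bnd_simp -?ltNge// integral_set0 lee_fin.
  by rewrite divr_ge0 ?powR_ge0// subr_ge0 ltW.
- rewrite /F xL set_itv1 integral_set1 lee_fin.
  by rewrite divr_ge0 ?powR_ge0// subr_ge0 ltW.
Qed.

(** Truncation makes the fractional integral on a segment of length L a
    convolution on the line with an integrable kernel. *)
Definition kern c L : R -> R := (fun s => (s `^ c)^-1) \_ `]0, L].

Lemma kern_ge0 c L s : 0 <= kern c L s.
Proof. by rewrite /kern patchE; case: ifP => // _; rewrite invr_ge0 powR_ge0. Qed.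

Lemma integrable_kern c L : c < 1 -> mu.-integrable setT (EFin \o kern c L).
Proof.
move=> /(integrable_powRN L); rewrite integrable_mkcond//.
apply: eq_integrable => // s _; rewrite /kern /= !patchE.
by case: ifP => // _; rewrite powRN.
Qed.

Lemma measurable_kern c L : measurable_fun setT (kern c L).
Proof.
apply/(measurable_restrictT _ _).1 => //.
apply: measurable_funTS.
under eq_fun do rewrite -powRN; exact: measurable_powR.
Qed.

Lemma integrable_expRN : mu.-integrable `]0, +oo[ (fun x => (expR (- x))%:E).
Proof.
apply: (@integrableS _ _ _ mu `[0, +oo[) => //.
  by apply: subset_itvr; rewrite bnd_simp.
apply/integrableP; split.
  apply/measurable_EFinP; apply: measurable_funTS; apply: continuous_measurable_fun.
  by move=> x; apply: continuous_comp; [exact: opp_continuous|exact: continuous_expR].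
under eq_integral do rewrite gee0_abs ?lee_fin ?expR_ge0//.
have dE (x : R) : is_derive x 1 (fun x => - expR (- x)) (expR (- x)).
  have D := is_derive1_comp (is_derive_expR (- x)) (is_deriveNid x 1).
  by have := is_deriveN D; rewrite mulrN1 opprK.
rewrite (@ge0_continuous_FTC2y _ _ (fun x => - expR (- x)) _ 0)//.
- by rewrite -EFinB ltry.
- by apply: continuous_subspaceT => x; apply: continuous_comp;
    [exact: opp_continuous|exact: continuous_expR].
- by rewrite -oppr0; apply: cvgN; exact: cvgr_expR.
- apply: cvgN; apply: cvg_at_right_filter.
  by apply: (@continuous_comp _ _ _ -%R expR); [exact: opp_continuous|exact: continuous_expR].
- by move=> x _; rewrite derive1E; have [] := dE x.
Qed.

(** The integral has to be shown finite as well, because the real-valued integral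
    of a function with infinite integral is 0. The integrand is dominated by
    the power on (0, 1] and by the exponential beyond, and it is at least
    expR (-1) on (0, 1]. *)
Lemma Gamma_gt0 s : 0 < s -> s <= 1 -> 0 < Gamma s.
Proof.
move=> s0 s1; pose f (x : R) := x `^ (s - 1) * expR (- x).
have mf : measurable_fun setT (EFin \o f).
  apply/measurable_EFinP; apply: measurable_funM; first exact: measurable_powR.
  apply: continuous_measurable_fun.
  by move=> x; apply: continuous_comp; [exact: opp_continuous|exact: continuous_expR].
have f0 x : 0 <= f x by rewrite mulr_ge0 ?powR_ge0 ?expR_ge0.
have fint : mu.-integrable `]0, +oo[ (EFin \o f).
  have I1 : mu.-integrable `]0, +oo[ (EFin \o kern (1 - s) 1).
    by apply: (@integrableS _ _ _ mu setT) => //; apply: integrable_kern; lra.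
  apply: le_integrable (integrableD _ I1 integrable_expRN) => //.
    exact: measurable_funTS.
  move=> x; rewrite /= in_itv/= andbT => x0.
  rewrite lee_fin !ger0_norm ?addr_ge0 ?kern_ge0 ?expR_ge0//.
  rewrite /f /kern patchE; case: ifPn => [|].
    rewrite -powRN opprB => _; rewrite -[leLHS]addr0 lerD ?expR_ge0//.
    by rewrite ler_piMr ?powR_ge0// -expR0 ler_expR; lra.
  rewrite notin_setE/= in_itv/= x0/= => /negP; rewrite -ltNge => x1.
  rewrite add0r ler_piMl ?expR_ge0//.
  have : x `^ (s - 1) <= x `^ 0 by apply: ler_powR; [exact: ltW|lra].
  by rewrite powRr0.
rewrite /Gamma -/f.
have : ((expR (-1))%:E <= \int[mu]_(x in `]0%R, +oo[) (f x)%:E)%E.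
  apply: (@le_trans _ _ (\int[mu]_(x in `]0%R, 1%R]) (f x)%:E)%E); last first.
    apply: ge0_subset_integral => //=.
    - exact: measurable_funTS.
    - by move=> x _; rewrite lee_fin.
    - by move=> x /=; rewrite !in_itv/= => /andP[->].
  have <- : (\int[mu]_(x in `]0%R, 1%R]) (expR (-1))%:E = (expR (-1))%:E)%E.
    by rewrite integral_cst//= lebesgue_measure_itv/= lte_fin ltr01 -EFinB subr0 mule1.
  apply: ge0_le_integral => //=.
  - exact: measurable_funTS.
  - move=> x; rewrite in_itv/= => /andP[x0 x1]; rewrite lee_fin.
    rewrite /f -[leLHS]mul1r ler_pM ?expR_ge0//; last by rewrite ler_expR; lra.
    have : x `^ 0 <= x `^ (s - 1) by apply: ger_powR; [rewrite x0|lra].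
    by rewrite powRr0.
rewrite -[X in (_ <= X)%E]fineK; last exact: integrable_fin_num.
by rewrite lee_fin; apply: lt_le_trans; exact: expR_gt0.
Qed.

End power_kernel.

(** * Fubini's theorem for convolutions *)

Section double_integrals.
Context {R : realType}.
Local Notation mu := (@lebesgue_measure R).
Implicit Types P W k : R -> R.

Lemma measurable_integral1 (f : measurableTypeR R * measurableTypeR R -> \bar R) :
  measurable_fun setT f -> measurable_fun setT (fun x => \int[mu]_y f (x, y))%E.
Proof.
move=> mf.
have -> : (fun x => \int[mu]_y f (x, y))%E =
    (fubini_F mu f^\+ \- fubini_F mu f^\-)%E.
  apply/funext => x; rewrite [LHS]integralE.
  by rewrite /fubini_F; congr (_ - _)%E; apply: eq_integral => y _; rewrite ?funeposE ?funenegE.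
apply: emeasurable_funB.
- apply: measurable_fun_fubini_tonelli_F => //; exact: measurable_funepos.
- apply: measurable_fun_fubini_tonelli_F => //; exact: measurable_funeneg.
Qed.

Lemma measurable_integral2 (f : measurableTypeR R * measurableTypeR R -> \bar R) :
  measurable_fun setT f -> measurable_fun setT (fun y => \int[mu]_x f (x, y))%E.
Proof.
move=> mf.
have -> : (fun y => \int[mu]_x f (x, y))%E =
    (fubini_G mu f^\+ \- fubini_G mu f^\-)%E.
  apply/funext => x; rewrite [LHS]integralE.
  by rewrite /fubini_F; congr (_ - _)%E; apply: eq_integral => y _; rewrite ?funeposE ?funenegE.
apply: emeasurable_funB.
- apply: measurable_fun_fubini_tonelli_G => //; exact: measurable_funepos.
- apply: measurable_fun_fubini_tonelli_G => //; exact: measurable_funeneg.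
Qed.

Lemma measurable_subr k z : measurable_fun setT k ->
  measurable_fun setT (fun y : R => k (y - z)).
Proof.
move=> mk; apply: measurableT_comp => //.
by apply: measurable_funB; [exact: measurable_id|exact: measurable_cst].
Qed.

Lemma measurable_subl k y : measurable_fun setT k ->
  measurable_fun setT (fun z : R => k (y - z)).
Proof.
move=> mk; apply: measurableT_comp => //.
by apply: measurable_funB; [exact: measurable_cst|exact: measurable_id].
Qed.

Definition conv k W (y : R) : R := \int[mu]_z (W z * k (y - z)).

Lemma integral_norm_shift k z : measurable_fun setT k ->
  (\int[mu]_y (`|k (y - z)|)%:E = \int[mu]_y (`|k y|)%:E)%E.
Proof.
move=> mk; pose k' (y : R) := `|k (0 - y)|%:E.
have mk' : measurable_fun setT k'.
  apply/measurable_EFinP; apply: measurableT_comp => //; exact: measurable_subl.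
have E1 := ge0_integral_reflection z mk' (fun y => normr_ge0 (k (0 - y))).
have mk0 : measurable_fun setT (fun y : R => `|k y|%:E).
  by apply/measurable_EFinP; apply: measurableT_comp.
have E2 := ge0_integral_reflection 0 mk0 (fun y => normr_ge0 (k y)).
transitivity (\int[mu]_x k' (z - x)%R)%E; last by rewrite E1 E2.
by apply: eq_integral => y _; rewrite /k' sub0r opprB.
Qed.

Section three_factors.
Variables P W k : R -> R.
Hypotheses (mP : measurable_fun setT P) (mW : measurable_fun setT W)
  (mk : measurable_fun setT k).

(** Both sides of the commutation of fractional and ordinary integration are
    iterated integrals of functions of this shape. *)
Definition triple (p : measurableTypeR R * measurableTypeR R) : \bar R :=
  (P p.1 * (W p.2 * k (p.1 - p.2)))%:E.

Let mWk : measurable_fun setT (fun p : measurableTypeR R * measurableTypeR R =>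
  (W p.2 * k (p.1 - p.2))%:E).
Proof.
apply/measurable_EFinP; apply: measurable_funM; first by apply: measurableT_comp.
apply: measurableT_comp => //; apply: measurable_funB => //.
Qed.

Let mPk : measurable_fun setT (fun p : measurableTypeR R * measurableTypeR R =>
  (P p.1 * k (p.1 - p.2))%:E).
Proof.
apply/measurable_EFinP; apply: measurable_funM; first by apply: measurableT_comp.
apply: measurableT_comp => //; apply: measurable_funB => //.
Qed.

Lemma measurable_triple : measurable_fun setT triple.
Proof.
apply/measurable_EFinP; apply: measurable_funM.
  by apply: measurableT_comp => //.
exact/measurable_EFinP.
Qed.

Let mabs : measurable_fun setT (abse \o triple).
Proof. by apply: measurableT_comp => //; exact: measurable_triple. Qed.

(** Integrate first in the variable of the kernel k: translation invariance
    bounds that integral by the norm of k. *)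
Lemma integrable_triple_kernel : (forall y, `|P y| <= 1) ->
  mu.-integrable setT (EFin \o W) -> mu.-integrable setT (EFin \o k) ->
  (mu \x mu)%E.-integrable setT triple.
Proof.
move=> P1 /integrableP[_ iW] /integrableP[_ ik].
apply/(integrable21ltyP _ _ measurable_triple).
set K := (\int[mu]_x `|(EFin \o k) x|)%E in ik.
have K0 : (0 <= K)%E by apply: integral_ge0.
have Kfin : K \is a fin_num by rewrite ge0_fin_numE.
apply: (@le_lt_trans _ _ (\int[mu]_z (K * `|(W z)%:E|))%E).
  apply: ge0_le_integral => //.
  - by move=> z _; apply: integral_ge0.
  - exact: (measurable_integral2 mabs).
  - apply: measurable_funeM; apply: measurableT_comp => //; exact/measurable_EFinP.
  move=> z _; apply: (@le_trans _ _ (\int[mu]_y (`|(W z)%:E| * (`|k (y - z)|)%:E))%E).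
    apply: ge0_le_integral => //.
    - apply: measurableT_comp => //; apply/measurable_EFinP.
      apply: measurable_funM => //; apply: measurable_funM => /=.
        exact: measurable_cst.
      exact: measurable_subr.
    - apply: measurable_funeM; apply/measurable_EFinP.
      apply: measurableT_comp => //; exact: measurable_subr.
    - move=> y _; rewrite /triple/= lee_fin normrM normrM.
      by rewrite ler_piMl ?mulr_ge0.
  rewrite ge0_integralZl//.
    by rewrite integral_norm_shift// muleC.
  by apply/measurable_EFinP; apply: measurableT_comp => //; exact: measurable_subr.
rewrite ge0_integralZl//.
  by rewrite lte_mul_pinfty.
by apply: measurableT_comp => //; exact/measurable_EFinP.
Qed.

Lemma integrable_triple_bounded : (forall y, `|k y| <= 1) ->
  mu.-integrable setT (EFin \o W) -> mu.-integrable setT (EFin \o P) ->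
  (mu \x mu)%E.-integrable setT triple.
Proof.
move=> k1 /integrableP[_ iW] /integrableP[_ iP].
apply/(integrable12ltyP _ _ measurable_triple).
set K := (\int[mu]_x `|(EFin \o W) x|)%E in iW.
have K0 : (0 <= K)%E by apply: integral_ge0.
have Kfin : K \is a fin_num by rewrite ge0_fin_numE.
apply: (@le_lt_trans _ _ (\int[mu]_z (K * `|(P z)%:E|))%E).
  apply: ge0_le_integral => //.
  - by move=> z _; apply: integral_ge0.
  - exact: (measurable_integral1 mabs).
  - apply: measurable_funeM; apply: measurableT_comp => //; exact/measurable_EFinP.
  move=> y _; apply: (@le_trans _ _ (\int[mu]_z (`|(P y)%:E| * (`|W z|)%:E))%E).
    apply: ge0_le_integral => //.
    - apply: measurableT_comp => //; apply/measurable_EFinP.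
      apply: measurable_funM => /=; first exact: measurable_cst.
      by apply: measurable_funM => //; exact: measurable_subl.
    - apply: measurable_funeM; apply/measurable_EFinP.
      by apply: measurableT_comp.
    - move=> z _; rewrite /triple/= lee_fin normrM normrM.
      by rewrite ler_wpM2l// ler_piMr.
  rewrite ge0_integralZl//.
    by rewrite muleC.
  by apply/measurable_EFinP; apply: measurableT_comp.
rewrite ge0_integralZl//.
  by rewrite lte_mul_pinfty.
by apply: measurableT_comp => //; exact/measurable_EFinP.
Qed.

Hypothesis iT : (mu \x mu)%E.-integrable setT triple.

(** Fubini's theorem for real-valued inner integrals. For almost every value of
    the outer variable the inner factor is integrable, unless the outer factor
    vanishes; in either case the outer factor can be moved outside. *)
Lemma triple_swap :
  (\int[mu]_y (P y * conv k W y)%:E =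
   \int[mu]_z (W z * \int[mu]_y (P y * k (y - z)))%:E)%E.
Proof.
have H1 : (\int[mu]_y (P y * conv k W y)%:E = \int[mu]_y \int[mu]_z triple (y, z))%E.
  apply: ae_eq_integral => //.
  - apply/measurable_EFinP; apply: measurable_funM => //.
    apply: measurableT_comp => //; exact: (measurable_integral1 mWk).
  - exact: (measurable_integral1 measurable_triple).
  have := ae_integrable1 iT; apply: (@filterS _ _ (ae_filter_ringOfSetsType _)).
  move=> y iy _; rewrite /triple/=; have [Py0|Py0] := eqVneq (P y) 0.
    rewrite Py0 mul0r; under eq_integral do rewrite mul0r.
    by rewrite integral0.
  have iWk : mu.-integrable setT (EFin \o (fun z => W z * k (y - z))).
    have := integrableZl measurableT (P y)^-1 iy.
    apply: eq_integrable => // z _; rewrite /triple/= -EFinM.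
    by rewrite mulKf.
  under eq_integral do rewrite EFinM.
  rewrite integralZl// EFinM /conv /Rintegral fineK//.
  exact: integrable_fin_num.
rewrite H1 (Fubini iT); apply: ae_eq_integral => //.
- exact: (measurable_integral2 measurable_triple).
- apply/measurable_EFinP; apply: measurable_funM => //.
  apply: measurableT_comp => //; exact: (measurable_integral2 mPk).
have := ae_integrable2 iT; apply: (@filterS _ _ (ae_filter_ringOfSetsType _)).
move=> z iz _; rewrite /triple/=; have [Wz0|Wz0] := eqVneq (W z) 0.
  rewrite Wz0 mul0r; under eq_integral do rewrite mul0r mulr0.
  by rewrite integral0.
have iPk : mu.-integrable setT (EFin \o (fun y => P y * k (y - z))).
  have := integrableZl measurableT (W z)^-1 iz.
  apply: eq_integrable => // y _; rewrite /triple/= -EFinM.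
  by rewrite mulrCA mulKf.
under eq_integral do rewrite mulrCA EFinM.
rewrite integralZl// EFinM /Rintegral fineK//.
exact: integrable_fin_num.
Qed.

End three_factors.

Section convolution.
Variables W k : R -> R.
Hypotheses (iW : mu.-integrable setT (EFin \o W))
  (ik : mu.-integrable setT (EFin \o k)).

Let mW : measurable_fun setT W.
Proof. by have /integrableP[/measurable_EFinP] := iW. Qed.

Let mk : measurable_fun setT k.
Proof. by have /integrableP[/measurable_EFinP] := ik. Qed.

Let iT : (mu \x mu)%E.-integrable setT (triple (cst 1%R) W k).
Proof. by apply: integrable_triple_kernel => // y; rewrite normr1. Qed.

Lemma conv_integrable_ae :
  {ae mu, forall y, mu.-integrable setT (fun z => (W z * k (y - z))%:E)}.
Proof.
have := ae_integrable1 iT; apply: (@filterS _ _ (ae_filter_ringOfSetsType _)).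
by move=> y; apply: eq_integrable => // z _; rewrite /triple/= mul1r.
Qed.

Lemma conv_integrable : mu.-integrable setT (EFin \o conv k W).
Proof.
have E y : conv k W y = fine (\int[mu]_z triple (cst 1%R) W k (y, z))%E.
  by congr fine; apply: eq_integral => z _; rewrite /triple/= mul1r.
apply: le_integrable (integrable_fubini_F iT) => //.
  apply/measurable_EFinP; apply: (@eq_measurable_fun _ _ _ _ _
     (fine \o (fun y => \int[mu]_z triple (cst 1%R) W k (y, z))%E)).
    by move=> y _; rewrite E.
  apply: measurableT_comp => //; apply: measurable_integral1.
  exact: measurable_triple.
by move=> y _; rewrite /= E /fubini_F; case: (\int[mu]_z _)%E => //=;
  rewrite normr0 leey.
Qed.

End convolution.

End double_integrals.

(** * Fractional integration commutes with integration *)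

Section RL_convolution.
Context {R : realType}.
Local Notation mu := (@lebesgue_measure R).
Variables (n : nat) (alpha a b : R).
Hypotheses (alpha_gt : n%:R - 1 < alpha) (alpha_le : alpha <= n%:R) (ab : a < b).
Implicit Types g w phi : R -> R.

Let c := alpha - n%:R + 1.
Let k := kern c (b - a).

(** At z = x the integrand is a quotient by 0, hence 0, in agreement with the
    kernel, which vanishes at 0. *)
Lemma patch_RL_integrand g x : 0 < c -> x \in `[a, b] ->
  RL_integrand n alpha g x \_ `[a, x] = fun z => (g \_ `[a, b]) z * k (x - z).
Proof.
rewrite in_itv/= => c0 /andP[ax xb]; apply/funext => z.
rewrite /k /kern !patchE !mem_setE !in_itv/= subr_gt0.
case: (leP a z) => az /=; last by rewrite mul0r.
case: (ltgtP z x) => [zx|xz|->] /=.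
- by rewrite (le_trans (ltW zx) xb) lerB//.
- by rewrite mulr0.
- by rewrite /RL_integrand subrr powR0 ?gt_eqF// invr0 !mulr0.
Qed.

Lemma RL_conv_conv g x : 0 < c -> alpha != n%:R -> x \in `[a, b] ->
  RL_conv n alpha a g x = conv k (g \_ `[a, b]) x.
Proof.
move=> c0 /negbTE an xab; rewrite /RL_conv an Rintegral_mkcond.
by rewrite patch_RL_integrand.
Qed.

Lemma RL_conv_defined_conv g x : 0 < c -> x \in `[a, b] ->
  mu.-integrable setT (fun z => ((g \_ `[a, b]) z * k (x - z))%:E) ->
  RL_conv_defined n alpha a g x.
Proof.
move=> c0 xab ig _; rewrite integrable_mkcond//; apply: eq_integrable ig => // z _.
have /(congr1 (fun h => (h z)%:E)) <- := patch_RL_integrand g c0 xab.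
by rewrite !patchE; case: ifP.
Qed.

Hypothesis an : alpha != n%:R.

Let c0 : 0 < c.
Proof. by move: alpha_gt; rewrite /c ltrBlDr -subr_gt0 addrAC. Qed.

Let c1 : c < 1.
Proof. by rewrite /c gtrDr subr_lt0 lt_neqAle an. Qed.

Let ik : mu.-integrable setT (EFin \o k). Proof. exact: integrable_kern. Qed.

Let mk : measurable_fun setT k. Proof. exact: measurable_kern. Qed.

Let ik_sub x : mu.-integrable setT (fun z => (k (x - z))%:E).
Proof.
apply/integrableP; split; first by apply/measurable_EFinP; exact: measurable_subl.
have mk' : measurable_fun setT (abse \o (EFin \o k)).
  by apply: measurableT_comp => //; exact/measurable_EFinP.
have E := ge0_integral_reflection x mk' (fun=> abse_ge0 _).
by have /integrableP[_] := ik; rewrite -[X in (X < _)%E -> _]E.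
Qed.

(** A continuous function on a segment is bounded, and the kernel is integrable. *)
Lemma RL_conv_defined_continuous phi x : {within `[a, b], continuous phi} ->
  x \in `[a, b] -> RL_conv_defined n alpha a phi x.
Proof.
move=> cphi xab; apply: RL_conv_defined_conv => //.
have mphi : measurable_fun setT (phi \_ `[a, b]).
  apply/(measurable_restrictT _ _).1 => //.
  exact: subspace_continuous_measurable_fun.
have [M M0 phiM] : exists2 M, 0 <= M & forall z, `|(phi \_ `[a, b]) z| <= M.
  have [M [_ HM]] := compact_bounded (continuous_compact cphi (@segment_compact _ a b)).
  exists (Num.max 0 (M + 1)); first by rewrite le_max lexx.
  move=> z; rewrite patchE; case: ifPn => zab; last by rewrite normr0 le_max lexx.
  rewrite le_max; apply/orP; right; apply: (HM (M + 1)); first by rewrite ltrDl.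
  by exists z => //; move: zab; rewrite inE.
have := integrableZl measurableT M (ik_sub x); apply: le_integrable => //.
  apply/measurable_EFinP; apply: measurable_funM => //; exact: measurable_subl.
move=> z _; rewrite -EFinM /= lee_fin !normrM (ger0_norm M0).
by rewrite ler_wpM2r.
Qed.

(** Write phi as the convolution of w with the Heaviside function th, and the
    integral over [a, x] as the pairing with the indicator Q. Exchanging the
    integrals turns each side of the identity into the integral of w against
    a function of t; one is the integral of k (x - z) over z in [t, x], the
    other that of k (y - t) over y in [t, x], and the reflection z = x + t - y
    identifies them. *)
Lemma RL_conv_primitive_lt phi w : mu.-integrable `[a, b] (EFin \o w) ->
  {in `[a, b], forall x, phi x = \int[mu]_(t in `[a, x]) w t} ->
  [/\ mu.-integrable `[a, b] (EFin \o RL_conv n alpha a w),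
      {ae mu, forall x, x \in `[a, b] -> RL_conv_defined n alpha a w x} &
      {in `[a, b], forall x, RL_conv n alpha a phi x =
        \int[mu]_(y in `[a, x]) RL_conv n alpha a w y}].
Proof.
move=> iw phiE; pose W := w \_ `[a, b].
have iW : mu.-integrable setT (EFin \o W).
  by move: iw; rewrite integrable_mkcond// -restrict_EFin.
have mW : measurable_fun setT W by have /integrableP[/measurable_EFinP] := iW.
split.
- apply: (@eq_integrable _ _ _ mu _ _ (EFin \o conv k W)) => //.
    by move=> x; rewrite inE/= => xab; rewrite /= RL_conv_conv.
  apply: (@integrableS _ _ _ mu setT) => //; exact: conv_integrable.
- have := conv_integrable_ae iW ik.
  apply: (@filterS _ _ (ae_filter_ringOfSetsType _)) => x ix xab.
  exact: RL_conv_defined_conv.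
move=> x xab.
have [ax xb] : a <= x /\ x <= b by move: xab; rewrite in_itv/= => /andP[].
pose P z : R := \1_(`[a, b]%classic : set R) z * k (x - z).
pose th : R -> R := \1_(`[0, +oo[%classic : set R).
pose Q : R -> R := \1_(`[a, x]%classic : set R).
have mQ : measurable_fun setT Q by exact: measurable_indic.
have mth : measurable_fun setT th by exact: measurable_indic.
have mP : measurable_fun setT P.
  by apply: measurable_funM; [exact: measurable_indic|exact: measurable_subl].
have Q1 y : `|Q y| <= 1.
  by rewrite /Q indicE; case: (_ \in _); rewrite ?normr1 ?normr0.
have th1 y : `|th y| <= 1.
  by rewrite /th indicE; case: (_ \in _); rewrite ?normr1 ?normr0.
have iP : mu.-integrable setT (EFin \o P).
  apply: le_integrable (ik_sub x) => //; first exact/measurable_EFinP.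
  move=> z _; rewrite /= lee_fin /P normrM ler_piMl// indicE.
  by case: (_ \in _); rewrite ?normr1 ?normr0.
have convth z : z \in `[a, b] -> conv th W z = phi z.
  move=> zab; rewrite phiE// /conv [RHS]Rintegral_mkcond.
  apply: eq_Rintegral => t _; rewrite /th /W indicE !patchE !mem_setE.
  move: zab; rewrite !in_itv/= andbT subr_ge0 => /andP[az zb].
  case: (leP a t) => at' /=; last by rewrite mul0r.
  case: (leP t z) => tz; last by rewrite mulr0.
  by rewrite (le_trans tz zb) mulr1.
have -> : RL_conv n alpha a phi x = \int[mu]_z (P z * conv th W z).
  rewrite RL_conv_conv//; apply: eq_Rintegral => z _.
  rewrite /P indicE patchE; case: ifPn => zab; last by rewrite !mul0r.
  by rewrite mul1r mulrC convth//; move: zab; rewrite inE.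
have -> : \int[mu]_(y in `[a, x]) RL_conv n alpha a w y =
    \int[mu]_y (Q y * conv k W y).
  rewrite Rintegral_mkcond; apply: eq_Rintegral => y _.
  rewrite /Q indicE patchE; case: ifPn => yax; last by rewrite mul0r.
  rewrite mul1r RL_conv_conv//; move: yax; rewrite mem_setE !in_itv/=.
  by move=> /andP[-> yx]; rewrite (le_trans yx).
have S1 := triple_swap mP mW mth (integrable_triple_bounded mP mW mth th1 iW iP).
have S2 := triple_swap mQ mW mk (integrable_triple_kernel mQ mW mk Q1 iW ik).
rewrite [LHS]/Rintegral [RHS]/Rintegral; congr fine.
apply: (etrans S1); apply: (etrans _ (esym S2)); apply: eq_integral => t _; congr (_%:E).
rewrite /W patchE; case: ifPn => [|_]; last by rewrite !mul0r.
rewrite mem_setE in_itv/= => /andP[at' tb]; congr (_ * _).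
have mQk : measurable_fun setT (fun y => Q y * k (y - t)).
  by apply: measurable_funM; [exact: mQ|exact: measurable_subr].
have Qk0 y : 0 <= Q y * k (y - t) by rewrite mulr_ge0 ?kern_ge0// /Q indicE.
rewrite -(Rintegral_reflection (x + t) mQk Qk0).
apply: eq_Rintegral => z _.
rewrite /P /Q /th !indicE !mem_setE !in_itv/= andbT.
have -> : x + t - z - t = x - z by ring.
have [xz|zx] := leP x z.
  suff -> : k (x - z) = 0 by rewrite !mulr0 mul0r.
  rewrite /k /kern patchE mem_setE in_itv/= subr_gt0.
  by rewrite ltNge xz.
have -> : (a <= x + t - z <= x) = (t <= z) by apply/andP/idP => [[]|?]; lra.
rewrite subr_ge0; have [tz|_] := leP t z; last by rewrite /= mul0r mulr0.
by rewrite (le_trans at' tz) (le_trans (ltW zx) xb) /= mulr1.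
Qed.

End RL_convolution.

Section RL_primitive.
Context {R : realType}.
Local Notation mu := (@lebesgue_measure R).
Variables (n : nat) (alpha a b : R).
Hypotheses (alpha_gt : n%:R - 1 < alpha) (alpha_le : alpha <= n%:R) (ab : a < b).

Lemma RL_conv_primitive (phi w : R -> R) : mu.-integrable `[a, b] (EFin \o w) ->
  {in `[a, b], forall x, phi x = \int[mu]_(t in `[a, x]) w t} ->
  [/\ mu.-integrable `[a, b] (EFin \o RL_conv n alpha a w),
      {ae mu, forall x, x \in `[a, b] -> RL_conv_defined n alpha a w x} &
      {in `[a, b], forall x, RL_conv n alpha a phi x =
        \int[mu]_(y in `[a, x]) RL_conv n alpha a w y}].
Proof.
have [->|an] := eqVneq alpha n%:R; last exact: RL_conv_primitive_lt.
move=> iw phiE; have E g : RL_conv n n%:R a g = g by rewrite /RL_conv eqxx.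
rewrite !E; split => //; first by apply: aeW => x _; rewrite /RL_conv_defined eqxx.
Qed.

Lemma RL_coef_neq0 : RL_coef n alpha != 0.
Proof.
rewrite /RL_coef; case: ifPn => [_|an]; first exact: oner_neq0.
have : alpha < n%:R by rewrite lt_neqAle an.
move=> an'; rewrite invr_eq0 gt_eqF// Gamma_gt0// ?subr_gt0//.
by rewrite lerBlDr -lerBlDl ltW.
Qed.

End RL_primitive.

(** * The fundamental theorem of calculus on a segment *)

Section fundamental_theorem_on_a_segment.
Context {R : realType}.
Local Notation mu := (@lebesgue_measure R).
Variables a b : R.
Hypothesis ab : a < b.
Implicit Types F w : R -> R.

Lemma ae_itvcc (P : R -> Prop) :
  {ae mu, forall x, x \in `]a, b[ -> P x} ->
  {ae mu, forall x, x \in `[a, b] -> P x}.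
Proof.
have N (c : R) : {ae mu, forall x, x != c}.
  exists [set c]; split => //; first exact: lebesgue_measure_set1.
  by move=> x /= /negP; rewrite negbK => /eqP.
move=> aeP; have aeP' : {ae mu, forall x, x \in `]a, b] -> P x}.
  apply: (@filterS2 _ _ (ae_filter_ringOfSetsType _) _ _ _ _ aeP (N b)) => x Px xb.
  rewrite in_itv/= => /andP[ax bx]; apply: Px.
  by rewrite in_itv/= ax lt_neqAle xb.
apply: (@filterS2 _ _ (ae_filter_ringOfSetsType _) _ _ _ _ aeP' (N a)) => x Px xa.
rewrite in_itv/= => /andP[ax bx]; apply: Px.
by rewrite in_itv/= bx lt_neqAle ax eq_sym xa.
Qed.

Lemma has_deriv_seg_is_derive F x l : x \in `]a, b[ ->
  has_deriv_seg a b F x l -> is_derive x 1 F l.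
Proof.
move=> xab; rewrite /has_deriv_seg incr_filter_in// => Fl.
have E : (fun h => h^-1 *: ((F \o shift x) (h *: 1) - F x)) =
    (fun h => (F (x + h) - F x) / h).
  by apply/funext => h; rewrite /= [_ *: 1]mulr1 mulrC [h + x]addrC.
split; first by rewrite /derivable E; apply/cvg_ex; exists l.
by rewrite /derive E; exact: cvg_lim.
Qed.

(** At the endpoints as well: the integrand is extended continuously to the line,
    where every point of the segment is interior, by starting the integral at
    a - 1. *)
Lemma continuous_primitive_has_deriv_seg F w x :
  {within `[a, b], continuous w} ->
  {in `[a, b], forall x, F x = F a + \int[mu]_(t in `[a, x]) w t} ->
  x \in `[a, b] -> has_deriv_seg a b F x (w x).
Proof.
move=> cw FE xab; pose w1 := w \o clamp a b.
have cw1 : continuous w1 by exact: continuous_clamp.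
have iw1 y : mu.-integrable `[a - 1, y] (EFin \o w1).
  apply: continuous_compact_integrable; first exact: segment_compact.
  exact: continuous_subspaceT.
pose F1 y := \int[mu]_(t in `[a - 1, y]) w1 t.
have [ax xb] : a <= x /\ x <= b by move: xab; rewrite in_itv/= => /andP[].
have [] := @continuous_FTC1_closed _ w1 (a - 1) x (b + 1) _ (iw1 _) _ (cw1 x); [lra|lra|].
move=> dF1 F1x; have w1x : w1 x = w x by rewrite /w1/= clamp_id.
have D1 : has_deriv_seg a b F1 x (w x).
  apply: is_derive_has_deriv_seg => //; apply: DeriveDef => //.
  by rewrite -derive1E F1x.
have D2 : has_deriv_seg a b (fun y => (F a - F1 a) + F1 y) x (0 + w x).
  by apply: has_deriv_segD => //; exact: is_derive_has_deriv_seg.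
move: D2; rewrite add0r; apply: eq_has_deriv_seg => // y yab.
have [ay yb] : a <= y /\ y <= b by move: yab; rewrite in_itv/= => /andP[].
rewrite [RHS]FE// -addrA; congr (_ + _); rewrite addrC /F1 Rintegral_itvB//.
- rewrite Rintegral_itv_obnd_cbnd.
    apply: eq_Rintegral => t; rewrite inE/= in_itv/= => /andP[at' ty].
    by rewrite /w1/= clamp_id// in_itv/= at' (le_trans ty).
  by apply: (integrableS _ _ _ (iw1 y)) => //; apply: subset_itvr; rewrite bnd_simp; lra.
- by rewrite bnd_simp; lra.
Qed.

Lemma has_deriv_seg_primitive F w : {within `[a, b], continuous F} ->
  {within `[a, b], continuous w} ->
  {in `[a, b], forall x, has_deriv_seg a b F x (w x)} ->
  {in `[a, b], forall x, F x = F a + \int[mu]_(t in `[a, x]) w t}.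
Proof.
move=> cF cw dF x; rewrite in_itv/= => /andP[]; rewrite le_eqVlt.
move=> /predU1P[<- _|ax xb].
  by rewrite set_itv1 Rintegral_set1 addr0.
have S : `[a, x]%classic `<=` `[a, b]%classic by apply: subset_itvl; rewrite bnd_simp.
have dF' y : y \in `]a, x[ -> is_derive y 1 F (w y).
  rewrite in_itv/= => /andP[ay yx]; apply: has_deriv_seg_is_derive.
    by rewrite in_itv/= ay (lt_le_trans yx).
  by apply: dF; rewrite in_itv/= !ltW// (lt_le_trans yx).
have cFx : {within `[a, x], continuous F} by exact: continuous_subspaceW S cF.
have dFx : derivable_oo_LRcontinuous F a x.
  have /(continuous_within_itvP _ ax)[_ cFa cFb] := cFx.
  by split => // y yax; have [] := dF' y yax.
have F'w : {in `]a, x[, F^`()%classic =1 w}.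
  by move=> y yax; rewrite derive1E; have [_] := dF' y yax.
rewrite /Rintegral (continuous_FTC2 ax (continuous_subspaceW S cw) dFx F'w) -EFinB /=.
by ring.
Qed.

Lemma primitive_continuous F w : mu.-integrable `[a, b] (EFin \o w) ->
  {in `[a, b], forall x, F x = \int[mu]_(t in `[a, x]) w t} ->
  {within `[a, b], continuous F}.
Proof.
move=> iw FE; have := parameterized_integral_continuous (ltW ab) iw.
by apply: subspace_eq_continuous => x; rewrite inE => xab; exact/esym/FE.
Qed.

(** The density of an absolutely continuous function is its derivative almost
    everywhere; being measurable, the derivative may replace it in integrals. *)
Theorem abs_continuous_deriv_seg F : {within `[a, b], continuous F} ->
  abs_continuous_seg a b F ->
  [/\ mu.-integrable `[a, b] (EFin \o deriv_seg a b F),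
      {ae mu, forall x, x \in `[a, b] -> has_deriv_seg a b F x (deriv_seg a b F x)} &
      {in `[a, b], forall x, F x = F a + \int[mu]_(t in `[a, x]) deriv_seg a b F t}].
Proof.
move=> cF acF; have [w iw FE] := abs_continuous_primitive ab acF.
have aeD := ae_itvcc (primitive_has_deriv_seg_ae ab iw FE).
have mD : measurable_fun `[a, b] (deriv_seg a b F) by exact: measurable_deriv_seg.
have mw : measurable_fun `[a, b] w by have /integrableP[/measurable_EFinP] := iw.
have aeE : {ae mu, forall x, x \in `[a, b] -> deriv_seg a b F x = w x}.
  apply: (@filterS _ _ (ae_filter_ringOfSetsType _) _ _ _ aeD) => x Dx xab.
  by have [_ ->] := (has_deriv_segP ab F (w x) xab).1 (Dx xab).
split.
- apply/integrableP; split; first exact/measurable_EFinP.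
  have /integrableP[_] := iw; congr (_ < _)%E.
  apply: ae_eq_integral => //.
  + by apply: measurableT_comp => //; exact/measurable_EFinP.
  + by apply: measurableT_comp => //; exact/measurable_EFinP.
  apply: (@filterS _ _ (ae_filter_ringOfSetsType _) _ _ _ aeE) => x Ex xab.
  by rewrite /= Ex.
- apply: (@filterS _ _ (ae_filter_ringOfSetsType _) _ _ _ aeD) => x Dx xab.
  have [dx _] := (has_deriv_segP ab F (w x) xab).1 (Dx xab).
  exact/(has_deriv_segP ab F _ xab).
- move=> x xab; rewrite FE//; congr (_ + _); rewrite /Rintegral; congr fine.
  have S : `[a, x]%classic `<=` `[a, b]%classic.
    by apply: subset_itvl; rewrite bnd_simp; move: xab; rewrite in_itv/= => /andP[].
  apply: ae_eq_integral => //.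
  + by apply/measurable_EFinP; exact: measurable_funS mw.
  + by apply/measurable_EFinP; exact: measurable_funS mD.
  apply: (@filterS _ _ (ae_filter_ringOfSetsType _) _ _ _ aeE) => y Ey yax.
  by rewrite Ey//; exact: S.
Qed.

End fundamental_theorem_on_a_segment.

(** * Chains of derivatives and Taylor sums *)

Section iterated_derivatives.
Context {R : realType}.
Variables a b : R.
Hypothesis ab : a < b.
Implicit Types (phi : R -> R) (h : nat -> R -> R).

(** Since [deriv_seg] at a point of the segment only sees values on the segment,
    candidates h k that are derivatives of one another there must be the
    iterated derivatives. *)
Lemma derivn_seg_chain N h phi : {in `[a, b], phi =1 h 0} ->
  (forall k, (k < N)%N -> {in `[a, b], forall x, has_deriv_seg a b (h k) x (h k.+1 x)}) ->
  forall k, (k <= N)%N -> {in `[a, b], derivn_seg a b k phi =1 h k}.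
Proof.
move=> phi0 dh; elim=> [//|k ih] kN x xab.
rewrite /derivn_seg iterS (@eq_deriv_seg _ _ _ ab _ (h k))//; last exact/ih/ltnW.
by have [] := (has_deriv_segP ab _ _ xab).1 (dh _ kN _ xab).
Qed.

Lemma nderivable_seg_chain N h phi : {in `[a, b], phi =1 h 0} ->
  (forall k, (k < N)%N -> {in `[a, b], forall x, has_deriv_seg a b (h k) x (h k.+1 x)}) ->
  forall k, (k <= N)%N -> {in `[a, b], forall x, nderivable_seg a b k phi x}.
Proof.
move=> phi0 dh; have D := derivn_seg_chain phi0 dh.
elim=> [//|k ih] kN x xab; split.
  have : \forall y \near within `[a, b] (nbhs x), y \in `[a, b] by exact: withinT.
  by apply: filterS => y; exact/ih/ltnW.
have [dk _] := (has_deriv_segP ab _ _ xab).1 (dh _ kN _ xab).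
by apply: eq_derivable_seg dk => // y yab; rewrite D// ltnW.
Qed.

(** The last derivative may exist at a single point only. *)
Lemma nderivable_seg_last N h phi x l : {in `[a, b], phi =1 h 0} ->
  (forall k, (k < N)%N -> {in `[a, b], forall x, has_deriv_seg a b (h k) x (h k.+1 x)}) ->
  x \in `[a, b] -> has_deriv_seg a b (h N) x l ->
  nderivable_seg a b N.+1 phi x /\ derivn_seg a b N.+1 phi x = l.
Proof.
move=> phi0 dh xab hl; have D := derivn_seg_chain phi0 dh.
have [dl El] := (has_deriv_segP ab _ _ xab).1 hl.
split; [split|].
- have : \forall y \near within `[a, b] (nbhs x), y \in `[a, b] by exact: withinT.
  by apply: filterS => y; exact: nderivable_seg_chain phi0 dh _ _ _.
- by apply: eq_derivable_seg dl => // y yab; rewrite D.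
- by rewrite /derivn_seg iterS (@eq_deriv_seg _ _ _ ab _ (h N))//; exact: D.
Qed.

End iterated_derivatives.

Section taylor_sums.
Context {R : realType}.
Implicit Types (a x : R) (u : nat -> R).

Definition taylor_sum a u m x : R := \sum_(j < m) u j / j`!%:R * (x - a) ^+ j.

Lemma taylor_sum_at a u m : taylor_sum a u m.+1 a = u 0.
Proof.
rewrite /taylor_sum big_ord_recl/= fact0 divr1 expr0 mulr1 big1 ?addr0// => i _.
by rewrite subrr expr0n/= mulr0.
Qed.

Lemma is_derive_taylor_sum a u m x :
  is_derive x 1 (taylor_sum a u m.+1) (taylor_sum a (fun j => u j.+1) m x).
Proof.
elim: m => [|m ih].
  have -> : taylor_sum a u 1 = cst (u 0).
    by apply/funext => y; rewrite /taylor_sum big_ord1 fact0 divr1 expr0 mulr1.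
  by rewrite /taylor_sum big_ord0; exact: is_derive_cst.
have -> : taylor_sum a u m.+2 = (fun y => taylor_sum a u m.+1 y +
    u m.+1 / (m.+1)`!%:R * (y - a) ^+ m.+1).
  by apply/funext => y; rewrite /taylor_sum big_ord_recr.
rewrite [X in is_derive _ _ _ X](_ : _ = taylor_sum a (fun j => u j.+1) m x +
  u m.+1 / m`!%:R * (x - a) ^+ m); last by rewrite /taylor_sum big_ord_recr.
apply: is_deriveD.
have D : is_derive x 1 (fun y => (y - a) ^+ m.+1) (m.+1%:R * (x - a) ^+ m).
  have D0 : is_derive x 1 (fun y => y - a) (1 - 0).
    exact: is_deriveB.
  by have := is_deriveX m.+1 D0; rewrite exprfctE subr0 /GRing.scale/= mulr1.
have := is_deriveZ (u m.+1 / (m.+1)`!%:R) D; congr (is_derive _ _ _ _).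
rewrite /GRing.scale/= factS natrM mulrA; congr (_ * _).
have m0 : (m.+1%:R : R) != 0 by rewrite pnatr_eq0.
have f0 : (m`!%:R : R) != 0 by rewrite pnatr_eq0 -lt0n fact_gt0.
move: (u m.+1) (m.+1%:R : R) (m`!%:R : R) m0 f0 => c p q p0 q0.
by field; rewrite p0 q0.
Qed.

End taylor_sums.

(** * Derivatives of the Taylor remainder *)

Section taylor_remainder_derivatives.
Context {R : realType}.
Local Notation mu := (@lebesgue_measure R).
Variables (N : nat) (a b : R) (f : R -> R).
Hypotheses (ab : a < b) (ACf : AC_seg a b N.+1 f).

Local Notation D k := (derivn_seg a b k f).

(** The k-th derivative of the Taylor remainder of order N + 1, for k <= N. *)
Definition remainder_deriv k (x : R) : R :=
  D k x - taylor_sum a (fun j => D (k + j)%N a) (N.+1 - k) x.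

Local Notation G := remainder_deriv.

Lemma taylor_remainder_deriv0 : taylor_remainder N.+1 a b f = G 0.
Proof. by []. Qed.

Lemma derivn_seg_has_deriv k x : (k < N)%N -> x \in `[a, b] ->
  has_deriv_seg a b (D k) x (D k.+1 x).
Proof.
move=> kN xab; have [d _ _] := ACf.
by apply/(has_deriv_segP ab _ _ xab); split => //; exact: d.
Qed.

Lemma remainder_deriv_has_deriv k x : (k < N)%N -> x \in `[a, b] ->
  has_deriv_seg a b (G k) x (G k.+1 x).
Proof.
move=> kN xab; pose T := taylor_sum a (fun j => D (k + j)%N a) (N.+1 - k).
have dT : has_deriv_seg a b (fun y => -1 * T y) x
    (-1 * taylor_sum a (fun j => D (k.+1 + j)%N a) (N.+1 - k.+1) x).
  apply: has_deriv_segZ => //; apply: is_derive_has_deriv_seg => //.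
  rewrite /T -(subnSK (leqW kN)).
  have -> : (fun j => D (k.+1 + j)%N a) = (fun j => D (k + j.+1)%N a).
    by apply/funext => j; rewrite addSnnS.
  exact: is_derive_taylor_sum.
have := has_deriv_segD ab xab (derivn_seg_has_deriv kN xab) dT.
rewrite mulN1r -/(G k.+1 x); apply: eq_has_deriv_seg => // y _.
by rewrite mulN1r.
Qed.

Lemma remainder_deriv_at k : (k <= N)%N -> G k a = 0.
Proof. by move=> kN; rewrite /G subSn// taylor_sum_at addn0 subrr. Qed.

Lemma remainder_deriv_continuous k : (k <= N)%N -> {within `[a, b], continuous (G k)}.
Proof.
move=> kN; have [_ cD _] := ACf.
have cT : {within `[a, b], continuous
    (taylor_sum a (fun j => D (k + j)%N a) (N.+1 - k))}.
  apply: continuous_subspaceT => x; rewrite subSn//.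
  apply: differentiable_continuous; apply/derivable1_diffP.
  by have [] := is_derive_taylor_sum a (fun j => D (k + j)%N a) (N - k) x.
by move=> x; apply: cvgB; [exact: cD|exact: cT].
Qed.

(** The derivative of [remainder_deriv k], for k <= N; it is written without a
    Taylor sum when k = N because the (N + 1)-st derivative of the Taylor
    polynomial is 0. *)
Definition remainder_integrand k : R -> R := if (k < N)%N then G k.+1 else D N.+1.

Lemma remainder_integrand_integrable k :
  mu.-integrable `[a, b] (EFin \o remainder_integrand k).
Proof.
rewrite /remainder_integrand; case: ifPn => kN.
  apply: continuous_compact_integrable; first exact: segment_compact.
  exact: remainder_deriv_continuous.
have [_ cD acD] := ACf.
by have [] := abs_continuous_deriv_seg ab (cD N (leqnn _)) acD.
Qed.

Lemma remainder_deriv_primitive k : (k <= N)%N ->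
  {in `[a, b], forall x, G k x = \int[mu]_(t in `[a, x]) remainder_integrand k t}.
Proof.
move=> kN x xab; rewrite /remainder_integrand; case: ifPn => kN'.
  have := has_deriv_seg_primitive (remainder_deriv_continuous kN)
    (remainder_deriv_continuous kN')
    (fun y yab => remainder_deriv_has_deriv kN' yab) xab.
  by rewrite remainder_deriv_at// add0r.
have -> : k = N by apply/eqP; rewrite eqn_leq kN leqNgt.
have [_ cD acD] := ACf.
have [_ _ DE] := abs_continuous_deriv_seg ab (cD N (leqnn _)) acD.
rewrite /G subSnn /taylor_sum big_ord1 addn0 fact0 divr1 expr0 mulr1.
by rewrite DE// addrC addKr.
Qed.

Lemma derivn_seg_ae :
  {ae mu, forall x, x \in `[a, b] -> nderivable_seg a b N.+1 f x}.
Proof.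
have [_ cD acD] := ACf.
have [_ aeD _] := abs_continuous_deriv_seg ab (cD N (leqnn _)) acD.
apply: (@filterS _ _ (ae_filter_ringOfSetsType _) _ _ _ aeD) => x Dx xab.
have [] // := @nderivable_seg_last _ _ _ ab N (fun k => D k) f x _ _ _ xab (Dx xab).
by move=> k kN y yab; exact: derivn_seg_has_deriv.
Qed.

End taylor_remainder_derivatives.

(** * The Riemann-Liouville derivative of the Taylor remainder *)

Section RL_derivative_of_the_remainder.
Context {R : realType}.
Local Notation mu := (@lebesgue_measure R).
Variables (N : nat) (alpha a b : R) (f : R -> R).
Hypotheses (alpha_gt : N.+1%:R - 1 < alpha) (alpha_le : alpha <= N.+1%:R).
Hypotheses (ab : a < b) (ACf : AC_seg a b N.+1 f).

Local Notation G := (remainder_deriv N a b f).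
Local Notation w := (remainder_integrand N a b f).
Local Notation J := (RL_conv N.+1 alpha a).

Let RLw k : (k <= N)%N ->
  [/\ mu.-integrable `[a, b] (EFin \o J (w k)),
      {ae mu, forall x, x \in `[a, b] -> RL_conv_defined N.+1 alpha a (w k) x} &
      {in `[a, b], forall x, J (G k) x = \int[mu]_(y in `[a, x]) J (w k) y}].
Proof.
move=> kN; apply: RL_conv_primitive => //.
- exact: remainder_integrand_integrable.
- exact: remainder_deriv_primitive.
Qed.

Let J0 k : (k <= N)%N -> J (G k) a = 0.
Proof.
move=> kN; have [_ _ ->] := RLw kN; last by rewrite in_itv/= lexx ltW.
by rewrite set_itv1 Rintegral_set1.
Qed.

(** The fractional integral of the k-th derivative is the primitive of that of
    the next one, which is continuous because it is a primitive in turn. *)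
Lemma RL_conv_remainder_has_deriv k x : (k < N)%N -> x \in `[a, b] ->
  has_deriv_seg a b (J (G k)) x (J (G k.+1) x).
Proof.
move=> kN xab; apply: continuous_primitive_has_deriv_seg => //.
  by have [iw _ wE] := RLw kN; exact: primitive_continuous iw wE.
move=> y yab; rewrite J0 ?add0r; last exact: ltnW.
by have [_ _ ->] := RLw (ltnW kN); rewrite // /remainder_integrand kN.
Qed.

(** N of the differentiations hold everywhere; the last one is applied to the
    primitive of an integrable function and holds almost everywhere. *)
Lemma RL_derive_remainder_ae :
  {ae mu, forall x, x \in `[a, b] ->
    RL_derivable N.+1 alpha a b (taylor_remainder N.+1 a b f) x /\
    RL_derive N.+1 alpha a b (taylor_remainder N.+1 a b f) x =
    RL_coef N.+1 alpha * J (derivn_seg a b N.+1 f) x}.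
Proof.
have [iw _ wE] := RLw (leqnn N).
have wN : w N = derivn_seg a b N.+1 f by rewrite /remainder_integrand ltnn.
have wE' : {in `[a, b], forall x, J (G N) x = J (G N) a + \int[mu]_(y in `[a, x]) J (w N) y}.
  by move=> x xab; rewrite J0// add0r wE.
have := ae_itvcc (primitive_has_deriv_seg_ae ab iw wE').
apply: (@filterS _ _ (ae_filter_ringOfSetsType _)) => x Dx xab.
pose h k y := RL_coef N.+1 alpha * J (G k) y.
have [] := @nderivable_seg_last _ _ _ ab N h
  (RL_integral N.+1 alpha a (taylor_remainder N.+1 a b f)) x
  (RL_coef N.+1 alpha * J (w N) x) _ _ xab _.
- by move=> y _.
- by move=> k kN y yab; apply: has_deriv_segZ => //; exact: RL_conv_remainder_has_deriv.
- by apply: has_deriv_segZ => //; exact: Dx.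
move=> nd dE; split; last by rewrite -wN.
split => // y yab an; move: (an); apply: RL_conv_defined_continuous yab => //.
by rewrite taylor_remainder_deriv0; exact: remainder_deriv_continuous.
Qed.

Lemma RL_conv_defined_derivn_ae :
  {ae mu, forall x, x \in `[a, b] ->
    RL_conv_defined N.+1 alpha a (derivn_seg a b N.+1 f) x}.
Proof.
by have [_ + _] := RLw (leqnn N); rewrite /remainder_integrand ltnn.
Qed.

End RL_derivative_of_the_remainder.

(** * The local fractional derivative *)

Section near_right.
Context {R : realType}.
Local Notation mu := (@lebesgue_measure R).

Lemma ae_near_ess_at_right (a b : R) (P : R -> Prop) : a < b ->
  {ae mu, forall x, x \in `[a, b] -> P x} -> \forall x \near ess_at_right a, P x.
Proof.
move=> ab aeP; exists (b - a); first by rewrite subr_gt0.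
apply: (@filterS _ _ (ae_filter_ringOfSetsType _) _ _ _ aeP) => x Px.
rewrite subrKC in_itv/= => /andP[ax xb]; apply: Px.
by rewrite in_itv/= !ltW.
Qed.

Lemma near_eq_fmap {T U : Type} (F : set_system T) {FF : Filter F} (g h : T -> U) :
  {near F, g =1 h} -> g @ F = h @ F.
Proof.
move=> gh; apply/seteqP; split; apply: near_eq_cvg => //.
by apply: filterS gh.
Qed.

End near_right.

Unset Implicit Arguments.

Theorem mainTheorem1 (R : realType) (n : nat) (alpha a b : R) (f : R -> R)
    (n_ge1 : (1 <= n)%N)
    (alpha_gt : n%:R - 1 < alpha) (alpha_le : alpha <= n%:R)
    (ab : a < b) (ACf : AC_seg a b n f) :
  (local_frac_derivable n alpha a b f <-> has_limit_conv_derivn n alpha a b f) /\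
  (local_frac_derivable n alpha a b f ->
     local_frac_derive n alpha a b f =
     RL_coef n alpha *
     lim (RL_conv n alpha a (derivn_seg a b n f) x @[x --> ess_at_right a])).
Proof.
case: n n_ge1 alpha_gt alpha_le ACf => [//|N] _ alpha_gt alpha_le ACf.
have nearRL := ae_near_ess_at_right ab (RL_derive_remainder_ae alpha_gt alpha_le ab ACf).
have nearf := ae_near_ess_at_right ab (derivn_seg_ae ab ACf).
have nearJ := ae_near_ess_at_right ab (RL_conv_defined_derivn_ae alpha_gt alpha_le ab ACf).
set J := RL_conv _ _ _ _ in nearRL *; set c := RL_coef _ _ in nearRL *.
have c0 : c != 0 := RL_coef_neq0 alpha_gt alpha_le.
have E : RL_derive N.+1 alpha a b (taylor_remainder N.+1 a b f) x @[x --> ess_at_right a] =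
    c * J x @[x --> ess_at_right a].
  by apply: near_eq_fmap; apply: filterS nearRL => x [].
have cJ l : J x @[x --> ess_at_right a] --> l ->
    c * J x @[x --> ess_at_right a] --> c * l.
  by move=> Jl; apply: cvgM => //; exact: cvg_cst.
have Jc : cvg (c * J x @[x --> ess_at_right a]) -> cvg (J x @[x --> ess_at_right a]).
  move=> /cvg_ex[l cl]; apply/cvg_ex; exists (c^-1 * l).
  have -> : J = (fun x => c^-1 * (c * J x)) by apply/funext => x; rewrite mulKf.
  by apply: cvgM => //; exact: cvg_cst.
have D : local_frac_derivable N.+1 alpha a b f -> cvg (J x @[x --> ess_at_right a]).
  by move=> [_]; rewrite E; exact: Jc.
split; last first.
  by move=> /D Jl; rewrite /local_frac_derive E; apply: cvg_lim => //; exact: cJ.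
split=> [/D//|[_ _ /cvg_ex[l Jl]]]; split.
  by apply: filterS nearRL => x [].
by rewrite E; apply/cvg_ex; exists (c * l); exact: cJ.
Qed.
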